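(* Let $M$ be a loopless matroid of rank $r$ on a finite ground set $E$, let $\mathcal G$ be a building set of $M$ containing $E$, and let $d=r-1$. For every $0\le k\le d$, $$\int_{M,\mathcal G}c_k(T_{M,\mathcal G})\,\alpha^{d-k}\ \ge\ \binom{d+1}{k}.$$
   Context: $M$ is a loopless matroid on a finite nonempty set $E$ with rank function $\operatorname{rk}$, $r=\operatorname{rk}(E)$, lattice of flats $\mathcal L(M)$ (minimum $\emptyset$, maximum $E$, join $\vee$). A subset $\mathcal G\subseteq\mathcal L(M)\setminus\{\emptyset\}$ is a building set if for every nonempty flat $F$, with $G_1,\dots,G_s$ the maximal elements of $\mathcal G$ contained in $F$, the join map $[\emptyset,G_1]\times\cdots\times[\emptyset,G_s]\to[\emptyset,F]$ is a poset isomorphism. A subset $\mathcal S\subseteq\mathcal G\setminus\{E\}$ is $\mathcal G$-nested if every collection of $m\ge2$ pairwise incomparable elements of $\mathcal S$ has join not in $\mathcal G$. In $N_E=\mathbb Z^E/\mathbb Z(1,\dots,1)$ let $v_F$ be the image of $\sum_{i\in F}e_i$; the nested-set fan $\Sigma_{M,\mathcal G}$ consists of the cones $\operatorname{cone}(v_F:F\in\mathcal S)$, $\mathcal S$ $\mathcal G$-nested, and $X_{M,\mathcal G}$ is its smooth toric variety. $\mathsf A(M,\mathcal G)$ is the Chow ring of $X_{M,\mathcal G}$, presented as $\mathbb Z[x_F:F\in\mathcal G\setminus\{E\}]$ modulo monomials $x_{F_1}\cdots x_{F_m}$ for non-nested $\{F_1,\dots,F_m\}$ and the linear forms $\sum_{F\ni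 i}x_F-\sum_{F\ni j}x_F$ ($i,j\in E$, sums over $F\in\mathcal G\setminus\{E\}$). Put $\alpha=\sum_{F\in\mathcal G\setminus\{E\},\,i\in F}x_F$ (independent of $i\in E$). $\int_{M,\mathcal G}:\mathsf A^{d}(M,\mathcal G)\to\mathbb Z$ is the degree isomorphism, normalized by $\int\alpha^d=1$. $\mathsf K(M,\mathcal G)=K_0(X_{M,\mathcal G})$; $\mathcal O(D)$ is the line bundle of $D\in\mathsf A^1(M,\mathcal G)$. For $F\in\mathcal G\setminus\{E\}$ put $\theta_F^{\mathcal G}=\alpha-\sum_{H\in\mathcal G,\,F\subseteq H\subsetneq E}x_H$. The tangent class is $$T_{M,\mathcal G}:=r[\mathcal O(\alpha)]-[\mathcal O]+\sum_{F\in\mathcal G\setminus\{E\}}\Big([\mathcal O(x_F)]-[\mathcal O]+\operatorname{rk}(F)\big([\mathcal O(\theta_F^{\mathcal G})]-[\mathcal O(\theta_F^{\mathcal G}+x_F)]\big)\Big)\in\mathsf K(M,\mathcal G),$$ so its total Chern class is $c(T_{M,\mathcal G})=(1+\alpha)^r\prod_{F\in\mathcal G\setminus\{E\}}(1+x_F)\left(\frac{1+\theta_F^{\mathcal G}}{1+\theta_F^{\mathcal G}+x_F}\right)^{\operatorname{rk}(F)}$, and $c_k$ denotes its degree-$k$ part. *)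

(* Defs.v *)
From HB Require Import structures.
From mathcomp Require Import all_boot all_order all_algebra.
From mathcomp Require Import boolp ring.
From mathcomp Require Import mpoly freeg.

Set Implicit Arguments.
Unset Strict Implicit.
Unset Printing Implicit Defensive.

Import GRing.Theory.
Local Open Scope ring_scope.

Record matroid (E : finType) := Matroid {
  rk : {set E} -> nat;
  rk_card : forall A, (rk A <= #|A|)%N;
  rk_mono : forall A B : {set E}, A \subset B -> (rk A <= rk B)%N;
  rk_submod : forall A B, (rk (A :|: B) + rk (A :&: B) <= rk A + rk B)%N
}.

Section Combinatorics.
Variables (E : finType) (M : matroid E).
Implicit Types (A F H : {set E}) (G S T : {set {set E}}).

Definition loopless := forall e : E, (0 < rk M [set e])%N.

Definition rank := rk M [set: E].

Definition cl A : {set E} := [set e | rk M (e |: A) == rk M A].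
Definition flat F : bool := cl F == F.

Definition join T : {set E} := cl (\bigcup_(F in T) F).

Definition maximal_in G F : {set {set E}} :=
  [set H in G | (H \subset F) &&
     [forall H' in G, (H' \subset F) ==> (H \subset H') ==> (H' == H)]].

(* An element of [0, G_1] x ... x [0, G_s], where G_1, ..., G_s are the
   elements of the set of flats T: a family indexed by the subtype of members
   of T. *)
Definition in_prod_itv T (f : {ffun {H | H \in T} -> {set E}}) : Prop :=
  forall B, flat (f B) /\ f B \subset val B.

Definition join_map T (f : {ffun {H | H \in T} -> {set E}}) : {set E} :=
  cl (\bigcup_B f B).

(* A poset isomorphism is a surjective order embedding. *)
Definition join_map_iso F T : Prop :=
  [/\ forall f, @in_prod_itv T f -> flat (join_map f) /\ join_map f \subset F,
      forall Y, flat Y -> Y \subset F ->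
        exists2 f, @in_prod_itv T f & join_map f = Y
    & forall f g, @in_prod_itv T f -> @in_prod_itv T g ->
        (join_map f \subset join_map g <-> forall B, f B \subset g B)].

Definition building_set G : Prop :=
  (forall F, F \in G -> flat F /\ F != set0) /\
  (forall F, flat F -> F != set0 -> join_map_iso F (maximal_in G F)).

Definition nested G S : bool :=
  (S \subset G :\ [set: E]) &&
  [forall T : {set {set E}}, [&& T \subset S, (1 < #|T|)%N &
     [forall F in T, [forall H in T, (F \subset H) ==> (F == H)]]]
     ==> (join T \notin G)].

End Combinatorics.

Section Span.
Variables (R : nzRingType) (V : lmodType R) (P : V -> Prop).

Definition spanned (v : V) : Prop :=
  exists s : seq (R * V),
    (forall u, u \in s -> P u.2) /\ v = \sum_(u <- s) u.1 *: u.2.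

Definition span_pred : {pred V} := fun v => `[< spanned v >].

Lemma spanP v : reflect (spanned v) (v \in span_pred).
Proof. exact: asboolP. Qed.

Lemma span0 : 0 \in span_pred.
Proof. by apply/spanP; exists [::]; rewrite big_nil. Qed.

Lemma spanD : {in span_pred &, forall u v, u + v \in span_pred}.
Proof.
move=> u v /spanP [s [hs ->]] /spanP [t [ht ->]]; apply/spanP.
exists (s ++ t); split; last by rewrite big_cat.
by move=> w; rewrite mem_cat => /orP [/hs | /ht].
Qed.

Lemma spanZ a : {in span_pred, forall u, a *: u \in span_pred}.
Proof.
move=> u /spanP [s [hs ->]]; apply/spanP.
exists [seq (a * w.1, w.2) | w <- s]; split; first by move=> w /mapP [w' /hs h ->].
rewrite big_map scaler_sumr; apply: eq_bigr => w _ /=.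
by rewrite scalerA.
Qed.

Lemma span_gen v : P v -> v \in span_pred.
Proof.
move=> Pv; apply/spanP; exists [:: (1, v)]; rewrite big_seq1 scale1r; split=> // u.
by rewrite inE => /eqP ->.
Qed.

Lemma span_zmod_closed : zmod_closed span_pred.
Proof.
split; first exact: span0.
by move=> u v hu hv; apply: spanD => //; rewrite -scaleN1r; apply: spanZ.
Qed.

End Span.

(* Power series 1 + a_1 t + a_2 t^2 + ... are handled as polynomials in t = 'X
   modulo t^(N+1), the precision N being a parameter. *)
Section TruncatedSeries.
Variables (A : comNzRingType) (N : nat).
Implicit Types (p q u v : {poly A}) (D : A) (n : int).

Definition teq p q : Prop := take_poly N.+1 p = take_poly N.+1 q.

Lemma teqP p q : teq p q <-> forall j, (j <= N)%N -> p`_j = q`_j.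
Proof.
split=> [e j hj | h].
  by have := congr1 (fun r : {poly A} => r`_j) e; rewrite !coef_take_poly ltnS hj.
by apply/polyP=> j; rewrite !coef_take_poly ltnS; case: ifP => // /h.
Qed.

Definition line_series D : {poly A} := 1 + D *: 'X.
Definition line_series_inv D : {poly A} := \sum_(j < N.+1) (- D *: 'X) ^+ j.

Definition line_series_pow D n : {poly A} :=
  match n with
  | Posz m => line_series D ^+ m
  | Negz m => line_series_inv D ^+ m.+1
  end.

Lemma teq_refl p : teq p p. Proof. by []. Qed.
Lemma teq_sym p q : teq p q -> teq q p. Proof. by []. Qed.
Lemma teq_trans q p r : teq p q -> teq q r -> teq p r.
Proof. by rewrite /teq => -> ->. Qed.

Lemma teqM p p' q q' : teq p p' -> teq q q' -> teq (p * q) (p' * q').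
Proof.
move=> /teqP hp /teqP hq; apply/teqP=> j hj; rewrite !coefM; apply: eq_bigr => i _.
have hi : (i <= j)%N by rewrite -ltnS.
by rewrite hp ?hq // ?(leq_trans hi) // (leq_trans _ hj) // leq_subr.
Qed.

Lemma teqX m p q : teq p q -> teq (p ^+ m) (q ^+ m).
Proof.
move=> h; elim: m => [|m IH]; first by rewrite !expr0.
by rewrite !exprS; apply: teqM.
Qed.

Lemma teq_prod (I : Type) (s : seq I) (P : pred I) (f g : I -> {poly A}) :
  (forall i, P i -> teq (f i) (g i)) ->
  teq (\prod_(i <- s | P i) f i) (\prod_(i <- s | P i) g i).
Proof. by move=> h; apply: (big_ind2 teq) => // *; exact: teqM. Qed.

Lemma teq_geom r : teq ((1 - 'X * r) * \sum_(j < N.+1) ('X * r) ^+ j) 1.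
Proof.
rewrite -[1 - _]opprB mulNr -subrX1 opprB; apply/teqP => j hj.
by rewrite coefB exprMn coefXnM ltnS hj subr0.
Qed.

Lemma teq_inv q : q`_0 = 1 -> exists w, teq (q * w) 1.
Proof.
move=> q0; pose r := 1 - q.
have /factor_theorem [s hs] : root r 0.
  by rewrite /root horner_coef0 coefB coef1 q0 subrr.
exists (\sum_(j < N.+1) ('X * s) ^+ j).
have -> : q = 1 - 'X * s.
  by move: hs; rewrite /r polyC0 subr0 mulrC => <-; rewrite opprB addrC subrK.
exact: teq_geom.
Qed.

Lemma teq_cancel q p p' : q`_0 = 1 -> teq (p * q) (p' * q) -> teq p p'.
Proof.
case/teq_inv=> w hw h.
have := teqM h (teq_refl w); rewrite -!mulrA => h'.
have e x : teq (x * (q * w)) x by rewrite -[X in teq _ X]mulr1; exact: teqM.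
exact: teq_trans (teq_sym (e p)) (teq_trans h' (e p')).
Qed.

Lemma line_series_invP D : teq (line_series D * line_series_inv D) 1.
Proof.
have e : - D *: 'X = 'X * (- D)%:P :> {poly A} by rewrite -mul_polyC mulrC.
rewrite /line_series_inv e.
have -> : line_series D = 1 - 'X * (- D)%:P by rewrite -e scaleNr opprK.
exact: teq_geom.
Qed.

Lemma line_series_pow0 D : line_series_pow D 0 = 1. Proof. by []. Qed.

Lemma line_series_powS D n :
  teq (line_series_pow D (n + 1)) (line_series_pow D n * line_series D).
Proof.
case: n => [m|[|m]] /=.
- by rewrite addn1 exprSr.
- by rewrite expr1 mulrC; exact/teq_sym/line_series_invP.
rewrite [X in teq _ (X * _)]exprSr -mulrA subn1 -[X in teq X _]mulr1; apply: teqM => //.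
by rewrite mulrC; exact/teq_sym/line_series_invP.
Qed.

Lemma line_series_coef0 D : (line_series D)`_0 = 1.
Proof. by rewrite coefD coef1 coefZ coefX mulr0 addr0. Qed.

Lemma line_series_powB1 D n :
  teq (line_series_pow D (n - 1) * line_series D) (line_series_pow D n).
Proof. by have := line_series_powS D (n - 1); rewrite subrK => /teq_sym. Qed.

Lemma line_series_powD D m n :
  teq (line_series_pow D (m + n)) (line_series_pow D m * line_series_pow D n).
Proof.
elim: n => [|n IH|n IH]; first by rewrite addr0 mulr1.
- rewrite intS (addrC 1) addrA.
  apply: teq_trans (line_series_powS _ _) _.
  apply: teq_trans (teqM IH (teq_refl _)) _; rewrite -mulrA; apply: teqM => //.
  exact/teq_sym/line_series_powS.
- apply: (teq_cancel (line_series_coef0 D)).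
  rewrite intS (addrC 1) opprD addrA.
  apply: teq_trans (line_series_powB1 _ _) _.
  apply: teq_trans IH _; rewrite -mulrA; apply: teqM => //.
  exact/teq_sym/line_series_powB1.
Qed.

End TruncatedSeries.

Section FormalChern.
Variables (A : comNzRingType) (P : zmodType) (c1 : {additive P -> A}).
Implicit Types (x y z : {freeg P / int}) (D L : P).

(* Whitney's formula for the virtual bundle \sum_D n_D [O(D)], where the first
   Chern class of O(D) is c1 D. *)
Definition whitney N x : {poly A} :=
  \prod_(D <- dom x) line_series_pow N (c1 D) (coeff D x).

Lemma whitney_sub N x (s : seq P) : uniq s -> {subset dom x <= s} ->
  whitney N x = \prod_(D <- s) line_series_pow N (c1 D) (coeff D x).
Proof.
move=> us hs; rewrite (bigID (mem (dom x))) /= [X in _ * X]big1 ?mulr1; last first.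
  by move=> D hD; rewrite coeff_outdom.
rewrite -big_filter; apply: perm_big; apply: uniq_perm; rewrite ?uniq_dom ?filter_uniq //.
by move=> D; rewrite mem_filter; case: (boolP (D \in dom x)) => // /hs ->.
Qed.

Lemma whitneyD N x y : teq N (whitney N (x + y)) (whitney N x * whitney N y).
Proof.
pose s := undup (dom x ++ dom y).
have us : uniq s by exact: undup_uniq.
have hs z : {subset dom z <= dom x ++ dom y} -> {subset dom z <= s}.
  by move=> h D /h; rewrite mem_undup.
rewrite !(@whitney_sub N _ s) //; first last.
- by apply: hs => D; exact: domD_subset.
- by apply: hs => D hD; rewrite mem_cat hD.
- by apply: hs => D hD; rewrite mem_cat hD orbT.
rewrite -big_split /=; apply: teq_prod => D _.
rewrite coeffD; exact: line_series_powD.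
Qed.

Lemma whitney0 N : whitney N 0 = 1.
Proof. by rewrite /whitney dom0 big_nil. Qed.

Lemma whitneyU N D : whitney N << D >> = line_series (c1 D).
Proof. by rewrite /whitney domU1 big_seq1 coeffU eqxx. Qed.

Lemma whitneyN N x : teq N (whitney N x * whitney N (- x)) 1.
Proof. by apply: teq_sym; rewrite -(whitney0 N) -(subrr x); exact: whitneyD. Qed.

Lemma whitneyMz N x n : teq N (whitney N x) 1 -> teq N (whitney N (x *~ n)) 1.
Proof.
move=> hx; elim: n => [|n IH|n IH]; first by rewrite mulr0z whitney0.
- rewrite intS (addrC 1) mulrzDr; apply: teq_trans (@whitneyD N _ _) _.
  by rewrite mulr1z -[X in teq _ _ X]mulr1; apply: teqM.
- rewrite intS (addrC 1) opprD mulrzDr (mulrNz x 1) mulr1z; apply: teq_trans (@whitneyD N _ _) _.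
  rewrite -[X in teq _ _ X]mulr1; apply: teqM => //.
  apply: (teq_trans _ (@whitneyN N x)).
  by rewrite -[X in teq _ X _]mul1r; exact: teqM (teq_sym hx) (teq_refl _ _).
Qed.

Lemma whitney_coef0 N x : (whitney N x)`_0 = 1.
Proof.
apply: (big_ind (fun p : {poly A} => p`_0 = 1)); first by rewrite coef1.
  by move=> p q hp hq; rewrite coef0M hp hq mulr1.
have h1 (p : {poly A}) n : p`_0 = 1 -> (p ^+ n)`_0 = 1 :> A.
  by move=> hp; rewrite -horner_coef0 horner_exp horner_coef0 hp expr1n.
move=> D _; case: (coeff _ _) => n; apply: h1; first exact: line_series_coef0.
have /teqP /(_ 0 isT) := line_series_invP N (c1 D).
by rewrite coef0M line_series_coef0 mul1r coef1.
Qed.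

Lemma whitney_prec N N' x : (N <= N')%N -> teq N (whitney N x) (whitney N' x).
Proof.
move=> hN; apply: teq_prod => D _; case: (coeff _ _) => n //=; apply: teqX.
apply: (teq_cancel (line_series_coef0 (c1 D))).
have h := line_series_invP N' (c1 D).
rewrite mulrC; apply: teq_trans (line_series_invP _ _) _.
apply/teqP => j hj; rewrite mulrC; move/teqP: h => -> //.
exact: leq_trans hj hN.
Qed.

(* [O(L)] (1 - [O(-D_1)]) ... (1 - [O(-D_m)]) in the group ring of P. *)
Fixpoint koszul (s : seq P) L : {freeg P / int} :=
  if s is D :: s' then koszul s' L - koszul s' (L - D) else << L >>.

Fixpoint koszul_frac (s : seq P) : {poly {poly A}} * {poly {poly A}} :=
  if s is D :: s' then
    let: (p, q) := koszul_frac s' in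
    let sh := 'X - (c1 D)%:P%:P in (p * (q \Po sh), q * (p \Po sh))
  else (1 + 'X *: 'X, 1).

Lemma koszul_fracP N s L :
  let: (p, q) := koszul_frac s in
  teq N (whitney N (koszul s L) * q.[(c1 L)%:P]) p.[(c1 L)%:P].
Proof.
elim: s L => [|D s IH] L /=.
  rewrite hornerC mulr1 whitneyU hornerD hornerC hornerZ hornerX.
  by rewrite /line_series -mul_polyC mulrC.
move: IH; case: (koszul_frac s) => p q IH.
have sh r : (r \Po ('X - (c1 D)%:P%:P)).[(c1 L)%:P] = r.[(c1 (L - D))%:P].
  by rewrite horner_comp hornerXsubC raddfB polyCB.
rewrite !hornerM !sh.
set W := koszul s L; set W' := koszul s (L - D).
set a := q.[_]; set b := p.[_]; set c := p.[_]; set d := q.[_].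
have h1 : teq N (whitney N W * a) c := IH L.
have h2 : teq N (whitney N W' * d) b := IH (L - D).
apply: teq_trans (teqM (@whitneyD N _ _) (teq_refl _ _)) _.
rewrite mulrACA; apply: teqM h1 _.
apply: teq_trans (teqM (teq_refl _ _) (teq_sym h2)) _.
rewrite mulrA -[X in teq _ _ X]mul1r; apply: teqM (teq_refl _ _).
by rewrite mulrC; exact: whitneyN.
Qed.

Lemma koszul_den_coef0 s L : let: (p, q) := koszul_frac s in
  p.[(c1 L)%:P]`_0 = 1 /\ q.[(c1 L)%:P]`_0 = 1.
Proof.
elim: s L => [|D s IH] L /=.
  rewrite hornerC hornerD hornerC hornerZ hornerX coefD coef1.
  by rewrite coefXM addr0.
move: IH; case: (koszul_frac s) => p q IH.
have sh r : (r \Po ('X - (c1 D)%:P%:P)).[(c1 L)%:P] = r.[(c1 (L - D))%:P].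
  by rewrite horner_comp hornerXsubC raddfB polyCB.
rewrite !hornerM !sh !coef0M.
by have [-> ->] := IH L; have [-> ->] := IH (L - D); rewrite mulr1.
Qed.

Lemma shift_dvd (a : {poly A}) (p : {poly {poly A}}) :
  exists q, p \Po ('X - a%:P) = p + a%:P * q.
Proof.
elim/poly_ind: p => [|p c [q hq]]; first by exists 0; rewrite comp_poly0 mulr0 addr0.
exists (q * ('X - a%:P) - p).
by rewrite comp_polyD comp_polyM comp_polyX comp_polyC hq; ring.
Qed.

Lemma koszul_frac_dvd (s : seq P) : let: (p, q) := koszul_frac s in
  exists h, p - q = (\prod_(D <- s) c1 D)%:P%:P * h.
Proof.
elim: s => [|D s IH] /=; first by exists ('X *: 'X); rewrite big_nil mul1r addrC addKr.
move: IH; case: (koszul_frac s) => p q [h hpq].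
have {hpq} -> : p = q + (\prod_(D <- s) c1 D)%:P%:P * h by rewrite -hpq addrC subrK.
set m := \prod_(D <- s) c1 D; rewrite big_cons -/m.
rewrite comp_polyD comp_polyM comp_polyC.
have [k ->] := shift_dvd (c1 D)%:P q; have [l ->] := shift_dvd (c1 D)%:P h.
exists (h * k - q * l); rewrite !polyCM; ring.
Qed.

Lemma whitney_koszul N s L :
  \prod_(D <- s) c1 D = 0 -> teq N (whitney N (koszul s L)) 1.
Proof.
move=> s0; have := koszul_fracP N s L; have := koszul_den_coef0 s L.
have := koszul_frac_dvd s; case: (koszul_frac s) => p q [h].
rewrite s0 !polyC0 mul0r => /eqP; rewrite subr_eq0 => /eqP -> [_ q0] e.
by apply: (teq_cancel q0); rewrite mul1r.
Qed.

Lemma whitney_span N (Q : {freeg P / int} -> Prop) x :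
    (forall y, Q y -> teq N (whitney N y) 1) ->
  x \in span_pred Q -> teq N (whitney N x) 1.
Proof.
move=> hQ /spanP [s [hs ->]]; elim: s hs => [|u s IH] hs.
  by rewrite big_nil whitney0.
rewrite big_cons; apply: teq_trans (@whitneyD N _ _) _.
rewrite -[X in teq _ _ X]mulr1; apply: teqM; last first.
  by apply: IH => v hv; apply: hs; rewrite inE hv orbT.
rewrite -[u.1]intz scaler_int; apply: whitneyMz; apply: hQ.
by apply: hs; rewrite inE eqxx.
Qed.

Lemma whitney_mod N (Q : {freeg P / int} -> Prop) x y :
    (forall z, Q z -> teq N (whitney N z) 1) ->
  x - y \in span_pred Q -> teq N (whitney N x) (whitney N y).
Proof.
move=> hQ /(whitney_span hQ) h; rewrite -[x](subrK y).
apply: teq_trans (@whitneyD N _ _) _.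
by rewrite -[X in teq _ _ X]mul1r; apply: teqM.
Qed.

End FormalChern.

Section ChowRing.
Variables (E : finType) (M : matroid E) (G : {set {set E}}).

(* The index type of the variables x_F. *)
Definition gvar : finType := {F : {set E} | F \in G :\ [set: E]}.

Definition polyring := {mpoly int[#|{: gvar}|]}.
HB.instance Definition _ := GRing.ComNzRing.on polyring.

Definition xvar (F : gvar) : polyring := 'X_(enum_rank F).

Definition nested_var (S : {set gvar}) : bool := nested M G (val @: S).

Variant chow_rel : polyring -> Prop :=
  | StanleyReisner (S : {set gvar}) of ~~ nested_var S :
      chow_rel (\prod_(F in S) xvar F)
  | Linear (i j : E) :
      chow_rel (\sum_(F : gvar | i \in val F) xvar F -
                \sum_(F : gvar | j \in val F) xvar F).

Definition chow_ideal : {pred polyring} := @span_pred polyring polyring^o chow_rel.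

Lemma nested_var0 : nested_var set0.
Proof.
rewrite /nested_var imset0 /nested sub0set /=.
apply/forallP => T; apply/implyP => /and3P [].
by rewrite subset0 => /eqP ->; rewrite cards0.
Qed.

Lemma chow_rel_at0 p : chow_rel p -> p.@[fun=> 0] = 0.
Proof.
have x0 F : (xvar F).@[fun=> 0] = 0 by rewrite mevalXU.
case=> [S hS | i j].
  have [F FS] : exists F, F \in S.
    by apply/set0Pn; apply: contra hS => /eqP ->; exact: nested_var0.
  by rewrite (bigD1 F) //= mevalM x0 mul0r.
have x0s (P : pred gvar) : (\sum_(F | P F) xvar F).@[fun=> 0] = 0.
  rewrite (raddf_sum (meval _)) big1 // => F _; exact: x0.
by rewrite mevalB !x0s subr0.
Qed.

Lemma chow_ideal_closed : idealr_closed chow_ideal.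
Proof.
split; first exact: span0.
- apply/negP => /spanP [s [hs e]].
  have /eqP := congr1 (meval (fun=> 0)) e.
  rewrite meval1 (raddf_sum (meval _)) big_seq big1 ?oner_eq0 // => u /hs /chow_rel_at0 h.
  have := mevalM (fun=> 0) (u.1 : polyring) u.2; rewrite h mulr0; exact.
- move=> a u v hu hv; apply: spanD => //.
  exact: (@spanZ _ polyring^o chow_rel a).
Qed.

HB.instance Definition _ := isIdealr.Build polyring chow_ideal chow_ideal_closed.

Definition chow := {ideal_quot chow_ideal}.
HB.instance Definition _ := GRing.ComNzRing.on chow.

Definition chow_pi (p : polyring) : chow := (\pi_({ideal_quot chow_ideal}) p)%qT.


Lemma chow_piM : {morph chow_pi : p q / p * q}.
Proof. exact: (rmorphM (\pi_({ideal_quot chow_ideal}))%qT). Qed.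

Lemma chow_piB : {morph chow_pi : p q / p - q}.
Proof. exact: (raddfB (\pi_({ideal_quot chow_ideal}))%qT). Qed.

Lemma chow_pi1 : chow_pi 1 = 1.
Proof. exact: (rmorph1 (\pi_({ideal_quot chow_ideal}))%qT). Qed.

Lemma chow_pi0 : chow_pi 0 = 0.
Proof. exact: (raddf0 (\pi_({ideal_quot chow_ideal}))%qT). Qed.

Lemma chow_pi_eq0 p : p \in chow_ideal -> chow_pi p = 0.
Proof.
move=> hp; rewrite -chow_pi0; apply/eqP.
by rewrite /chow_pi -Quotient.idealrBE subr0.
Qed.

(* The graded piece A^k, as a subgroup of the Chow ring. *)
Definition gr (k : nat) : {pred chow} :=
  fun a => `[< exists2 p : polyring, p \is k.-homog & a = chow_pi p >].

Lemma grP k a :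
  reflect (exists2 p : polyring, p \is k.-homog & a = chow_pi p) (a \in gr k).
Proof. exact: asboolP. Qed.

Lemma gr_zmod_closed k : zmod_closed (gr k).
Proof.
split; first by apply/grP; exists 0; [exact: rpred0 | rewrite chow_pi0].
move=> a b /grP [p hp ->] /grP [q hq ->]; apply/grP; exists (p - q).
  exact: rpredB.
by rewrite chow_piB.
Qed.

HB.instance Definition _ k := GRing.isZmodClosed.Build chow (gr k) (gr_zmod_closed k).

Lemma gr1_one : 1 \in gr 0.
Proof. by apply/grP; exists 1; [exact: dhomog1 | rewrite chow_pi1]. Qed.

Lemma grM j k a b : a \in gr j -> b \in gr k -> a * b \in gr (j + k).
Proof.
move=> /grP [p hp ->] /grP [q hq ->]; apply/grP; exists (p * q).
  exact: dhomogM.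
by rewrite chow_piM.
Qed.

(* Pic(X_{M,G}) = A^1(M,G): the divisor class D stands for O(D). *)
Definition pic : Type := {D : chow | D \in gr 1}.
HB.instance Definition _ := SubChoice.on pic.
HB.instance Definition _ := [SubChoice_isSubZmodule of pic by <:].

Definition c1 : {additive pic -> chow} := val.

Lemma xvar_gr1 F : chow_pi (xvar F) \in gr 1.
Proof. by apply/grP; exists (xvar F) => //; rewrite dhomogX; apply/eqP; exact: mdeg1. Qed.

Definition x_ (F : gvar) : pic := Sub (chow_pi (xvar F)) (xvar_gr1 F).

(* This does not depend on i : see alpha_indep. *)
Definition alpha (i : E) : pic := \sum_(F : gvar | i \in val F) x_ F.

Definition theta (i : E) (F : gvar) : pic :=
  alpha i - \sum_(H : gvar | val F \subset val H) x_ H.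

(* The Grothendieck group of the smooth toric variety X_{M,G}: it is generated
   by the classes of line bundles, subject to the relations
   [O(L)] \prod_(F in S) (1 - [O(- x_F)]) = 0, for L in Pic and S not nested. *)
Variant k0_rel : {freeg pic / int} -> Prop :=
  | K0Rel (S : {set gvar}) (L : pic) of ~~ nested_var S :
      k0_rel (koszul [seq x_ F | F <- enum S] L).

Definition k0_sub : {pred {freeg pic / int}} := span_pred k0_rel.
HB.instance Definition _ :=
  GRing.isZmodClosed.Build {freeg pic / int} k0_sub (span_zmod_closed k0_rel).

Definition K0 : Type := Quotient.quot k0_sub.
HB.instance Definition _ := GRing.Zmodule.on K0.
HB.instance Definition _ := Quotient.on K0.

Definition line_bundle (D : pic) : K0 := (\pi_(Quotient.quot k0_sub) << D >>)%qT.

(* c_k is the coefficient of t^k in the Chern polynomial c_t, which is given by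
   Whitney's formula on a representative as a combination of line bundles; see
   chern0, chernD and chern_line. *)
Definition chern (k : nat) (X : K0) : chow := (whitney c1 k (repr X))`_k.

Definition tangent (i : E) : K0 :=
  line_bundle (alpha i) *+ rank M - line_bundle 0 +
  \sum_(F : gvar)
     (line_bundle (x_ F) - line_bundle 0 +
      (line_bundle (theta i F) - line_bundle (theta i F + x_ F)) *+ rk M (val F)).

(* A degree isomorphism A^d -> Z; only the values of deg on A^d matter. *)
Definition degree_iso (i : E) (d : nat) (deg : chow -> int) : Prop :=
  [/\ {in gr d &, {morph deg : a b / a + b}},
      {in gr d &, injective deg},
      forall n : int, exists2 a, a \in gr d & deg a = n
    & deg (c1 (alpha i) ^+ d) = 1].




Lemma alpha_indep i j : alpha i = alpha j.
Proof.
apply: val_inj; rewrite -[LHS]/(c1 _) -[RHS]/(c1 _) /alpha !raddf_sum /=.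
apply/eqP; rewrite -subr_eq0; apply/eqP.
have e (P : pred gvar) : \sum_(F | P F) val (x_ F) = chow_pi (\sum_(F | P F) xvar F).
  exact/esym/(raddf_sum (\pi_({ideal_quot chow_ideal}))%qT).
rewrite !e -chow_piB; apply: chow_pi_eq0; exact: (@span_gen polyring polyring^o _ _ (Linear i j)).
Qed.

Lemma x_nonnested (S : {set gvar}) :
  ~~ nested_var S -> \prod_(D <- [seq x_ F | F <- enum S]) c1 D = 0.
Proof.
move=> hS; rewrite big_map big_enum /=.
have -> : \prod_(F in S) val (x_ F) = chow_pi (\prod_(F in S) xvar F).
  exact/esym/(rmorph_prod (\pi_({ideal_quot chow_ideal}))%qT).
apply: chow_pi_eq0; exact: (@span_gen polyring polyring^o _ _ (StanleyReisner hS)).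
Qed.

Lemma whitney_repr N (u : {freeg pic / int}) :
  teq N (whitney c1 N (repr (\pi_(Quotient.quot k0_sub) u)%qT)) (whitney c1 N u).
Proof.
apply: (@whitney_mod _ _ c1 N k0_rel).
  by move=> _ [S L /x_nonnested hS]; exact: whitney_koszul.
have := Quotient.idealrBE k0_sub (repr (\pi_(Quotient.quot k0_sub) u)%qT) u.
by rewrite reprK eqxx.
Qed.

Lemma k0_reprK (X : K0) : X = (\pi_(Quotient.quot k0_sub) (repr X))%qT.
Proof. by rewrite reprK. Qed.

Lemma chern_pi k u : chern k (\pi_(Quotient.quot k0_sub) u)%qT = (whitney c1 k u)`_k.
Proof. by have /teqP /(_ k (leqnn k)) := @whitney_repr k u. Qed.

Lemma whitney_K0D N X Y : teq N (whitney c1 N (repr (X + Y : K0)))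
  (whitney c1 N (repr X) * whitney c1 N (repr Y)).
Proof.
apply: teq_trans (whitneyD _ _ _ _).
rewrite [in X in teq _ X _](k0_reprK X) [in X in teq _ X _](k0_reprK Y).
rewrite -(raddfD (\pi_(Quotient.quot k0_sub))%qT); exact: whitney_repr.
Qed.

Lemma chern_coef k N X : (k <= N)%N -> chern k X = (whitney c1 N (repr X))`_k.
Proof. by move=> hk; have /teqP /(_ k (leqnn k)) := whitney_prec c1 (repr X) hk. Qed.

Lemma chern0 X : chern 0 X = 1.
Proof. exact: whitney_coef0. Qed.

(* Whitney's sum formula. *)
Lemma chernD k X Y : chern k (X + Y) = \sum_(i < k.+1) chern i X * chern (k - i) Y.
Proof.
have /teqP /(_ k (leqnn k)) := whitney_K0D k X Y; rewrite -/(chern k _) coefM => e; rewrite e {e}.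
by apply: eq_bigr => i _; rewrite -!(@chern_coef _ k) ?leq_subr // -ltnS.
Qed.

Lemma chern_line k (D : pic) : chern k (line_bundle D) = (1 + c1 D *: 'X : {poly chow})`_k.
Proof. by rewrite chern_pi whitneyU. Qed.

Lemma chern_gr k X : chern k X \in gr k.
Proof.
have gr0 j : 0 \in gr j by exact: rpred0.
pose Q (p : {poly chow}) := forall j, p`_j \in gr j.
have Q1 : Q 1 by case=> [|j]; rewrite coef1 //=; exact: gr1_one.
have QM p q : Q p -> Q q -> Q (p * q).
  move=> hp hq j; rewrite coefM; apply: rpred_sum => i _.
  have hi : (i <= j)%N by rewrite -ltnS.
  by have := grM (hp i) (hq (j - i)%N); rewrite subnKC.
have QX p n : Q p -> Q (p ^+ n).
  by move=> hp; elim: n => [|n IH]; rewrite ?expr0 // exprS; exact: QM.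
have QD p q : Q p -> Q q -> Q (p + q).
  by move=> hp hq j; rewrite coefD; exact: rpredD.
have Ql (a : chow) : a \in gr 1 -> Q (a *: 'X).
  by move=> ha [|[|j]]; rewrite coefZ coefX ?mulr0 ?mulr1 //.
suff h : Q (whitney c1 k (repr X)) by exact: h.
apply: big_ind => // D _; case: (coeff _ _) => n; apply: (QX).
  by apply: (QD) => //; apply: (Ql); exact: valP.
rewrite /line_series_pow /line_series_inv; apply: (big_ind Q) => [j|p q|j _].
- by rewrite coef0.
- exact: QD.
by apply: (QX); apply: (Ql); rewrite rpredN; exact: valP.
Qed.

(* c(T) = (1 + alpha)^r \prod_F (1 + x_F)
            ((1 + theta_F) / (1 + theta_F + x_F))^rk(F). *)
Lemma chern_tangent i k :
  let inv D := line_series_inv k (c1 D) in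
  chern k (tangent i) =
    (line_series (c1 (alpha i)) ^+ rank M *
     \prod_(F : gvar) (line_series (c1 (x_ F)) *
       (line_series (c1 (theta i F)) * inv (theta i F + x_ F)) ^+ rk M (val F)))`_k.
Proof.
move=> inv.
pose c (X : K0) := whitney c1 k (repr X).
have cD X Y : teq k (c (X + Y)) (c X * c Y) by exact: whitney_K0D.
have cL D : teq k (c (line_bundle D)) (line_series (c1 D)).
  by apply: teq_trans (whitney_repr _ _) _; rewrite whitneyU.
have c0 : teq k (c 0) 1.
  have := whitney_repr k 0; rewrite whitney0.
  by rewrite (raddf0 (\pi_(Quotient.quot k0_sub))%qT).
have s0 : line_series (c1 0) = 1 by rewrite raddf0 /line_series scale0r addr0.
have cN X p q : teq k (c X) p -> teq k (p * q) 1 -> teq k (c (- X)) q.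
  move=> hX hpq; have := cD X (- X); rewrite subrr => h.
  have {h} h : teq k (c X * c (- X)) 1 by apply: teq_trans (teq_sym h) c0.
  have h' : teq k (q * (c X * c (- X))) (c (- X)).
    rewrite mulrA -[X in teq _ _ X]mul1r; apply: teqM (teq_refl _ _).
    by rewrite mulrC; apply: teq_trans (teqM hX (teq_refl _ _)) hpq.
  apply: teq_trans (teq_sym h') _.
  by rewrite -[X in teq _ _ X]mulr1; exact: teqM (teq_refl _ _) h.
have cB X Y p q w : teq k (c X) p -> teq k (c Y) q -> teq k (q * w) 1 ->
    teq k (c (X - Y)) (p * w).
  by move=> hX hY hq; apply: teq_trans (cD _ _) _; apply: teqM hX (cN _ _ _ hY hq).
have cX X p n : teq k (c X) p -> teq k (c (X *+ n)) (p ^+ n).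
  move=> hX; elim: n => [|n IH]; first by rewrite mulr0n expr0.
  by rewrite mulrS exprS; apply: teq_trans (cD _ _) _; exact: teqM.
have c1O : teq k (c (line_bundle 0)) 1 by rewrite -s0.
have u1 : teq k (1 * 1 : {poly chow}) 1 by rewrite mulr1.
suff /teqP h : teq k (c (tangent i))
  (line_series (c1 (alpha i)) ^+ rank M *
     \prod_(F : gvar) (line_series (c1 (x_ F)) *
       (line_series (c1 (theta i F)) * inv (theta i F + x_ F)) ^+ rk M (val F))).
  by rewrite -h.
apply: teq_trans (cD _ _) _; apply: teqM.
  rewrite -[X in teq _ _ X]mulr1; exact: cB (cX _ _ _ (cL _)) c1O u1.
apply: (big_ind2 (fun X p => teq k (c X) p)) => // [X p Y q hX hY | F _].
  by apply: teq_trans (cD _ _) _; exact: teqM.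
apply: teq_trans (cD _ _) _; apply: teqM.
  rewrite -[X in teq _ _ X]mulr1; exact: cB (cL _) c1O u1.
apply: (cX); apply: (cB) (cL _) (cL _) _; exact: line_series_invP.
Qed.

End ChowRing.

Arguments c1 {E M G}.

(* Main.v *)
(* Write theta_F + x_F = xi_F and rk F = n.  The factor
     (1 + x_F) ((1 + theta_F) / (1 + xi_F))^n
   equals 1 + x_F (L + (n-1) theta_F^(n-1) / (1 + xi_F)^n + theta_F^n / (1 + xi_F)^n) with L of
   degree < n - 1 in theta_F.  Expand the product over F, by increasing size of F.  After
   multiplication by the monomial of a nested set S of flats already treated, and with n
   replaced by n_F = rk (S v F) - rk S, the power theta_F^(n_F) vanishes, L contributes
   nothing in top degree for dimension reasons, and in the remaining term the relation
     (1 + alpha) \prod_(H > F) (1 + theta_H) / (1 + xi_H) = 1 + xi_F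
   turns 1 / (1 + xi_F)^(n_F) into the shift of exponents of alpha and of the later factors
   from S to S + F.  As \prod_(F in S) x_F theta_F^(n_F - 1) alpha^(d - rk S) = alpha^d, this yields
     c_k alpha^(d-k) = \sum_S \prod_(F in S) (n_F - 1) 'C(r - rk S, k - rk S) alpha^d,
   where all terms are nonnegative and S = set0 contributes 'C(d + 1, k). *)

Require Import Defs.
From mathcomp Require Import all_boot all_order all_algebra.
From mathcomp Require Import zify ring.

Set Implicit Arguments.
Unset Strict Implicit.
Unset Printing Implicit Defensive.

Import GRing.Theory.
Local Open Scope ring_scope.

(** * Rank and closure in a matroid *)

Section MatroidTheory.
Variables (E : finType) (M : matroid E).
Implicit Types A B C F H : {set E}.
Local Notation rk := (rk M).
Local Notation cl := (cl M).

Lemma rk0 : rk set0 = 0%N.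
Proof. by have := rk_card M set0; rewrite cards0; case: (Defs.rk M set0). Qed.

(** Diminishing returns: submodularity for [A :|: C] and [B], whose union is [B :|: C] and whose
    intersection contains [A]. *)
Lemma rkU_submod A B C : A \subset B -> (rk (B :|: C) + rk A <= rk (A :|: C) + rk B)%N.
Proof.
move=> sAB; have := rk_submod M (A :|: C) B.
have -> : A :|: C :|: B = B :|: C by rewrite setUC setUA (setUidPl sAB).
have /(rk_mono M) : A \subset (A :|: C) :&: B by rewrite subsetI subsetUl.
by lia.
Qed.

Lemma rkU_le A B : (rk (A :|: B) <= rk A + rk B)%N.
Proof. by have := rk_submod M A B; lia. Qed.

Lemma rk_bigcup_le (I : finType) (P : pred I) (A : I -> {set E}) :
  (rk (\bigcup_(i | P i) A i) <= \sum_(i | P i) rk (A i))%N.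
Proof.
apply: (big_ind2 (fun X n => (rk X <= n)%N)) => // [|X m Y n hX hY]; first by rewrite rk0.
exact: leq_trans (rkU_le _ _) (leq_add hX hY).
Qed.

Lemma in_cl A e : (e \in cl A) = (rk (e |: A) == rk A).
Proof. by rewrite inE. Qed.

Lemma rk_notin_cl A e : e \notin cl A -> rk (e |: A) = (rk A).+1.
Proof.
rewrite in_cl; have := rkU_le [set e] A; have := rk_card M [set e]; rewrite cards1.
by have := rk_mono M (subsetUr [set e] A); lia.
Qed.

Lemma sub_cl A : A \subset cl A.
Proof. by apply/subsetP=> e eA; rewrite in_cl (setUidPr _) // sub1set. Qed.

Lemma cl_mono A B : A \subset B -> cl A \subset cl B.
Proof.
move=> sAB; apply/subsetP=> e; rewrite !in_cl => /eqP h.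
have := rkU_submod [set e] sAB; rewrite ![_ :|: [set e]]setUC h.
by have := rk_mono M (subsetUr [set e] B); lia.
Qed.

(** The elements of [B] are added one at a time; each leaves the rank of [A] unchanged, hence by
    diminishing returns that of any larger set. *)
Lemma rkU_cl A B : B \subset cl A -> rk (A :|: B) = rk A.
Proof.
move=> sBA; have -> : B = [set x in enum B] by apply/setP=> x; rewrite inE mem_enum.
have : all (mem (cl A)) (enum B).
  by apply/allP=> x; rewrite mem_enum => /(subsetP sBA).
elim: (enum B) => [_|b s IH /= /andP [hb /IH h]].
  by congr rk; apply/setP=> x; rewrite !inE orbF.
have -> : [set x in b :: s] = b |: [set x in s] by apply/setP=> x; rewrite !inE.
rewrite setUCA; move: hb; rewrite in_cl => /eqP hb.
have := rkU_submod [set b] (subsetUl A [set x in s]).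
rewrite ![_ :|: [set b]]setUC hb h.
have := rk_mono M (subsetUr [set b] (A :|: [set x in s])).
by rewrite h; lia.
Qed.

Lemma rk_cl A : rk (cl A) = rk A.
Proof. by rewrite -[RHS](rkU_cl (subxx _)) (setUidPr _) ?sub_cl. Qed.

Lemma cl_idem A : cl (cl A) = cl A.
Proof.
apply/eqP; rewrite eqEsubset sub_cl andbT; apply/subsetP=> e.
rewrite !in_cl => /eqP h.
have := rk_mono M (setUS [set e] (sub_cl A)); rewrite h rk_cl.
by have := rk_mono M (subsetUr [set e] A); lia.
Qed.

Lemma cl_sub A B : (cl A \subset cl B) = (A \subset cl B).
Proof.
apply/idP/idP => [|/cl_mono]; last by rewrite cl_idem.
exact/subset_trans/sub_cl.
Qed.

Lemma flat_cl A : flat M (cl A).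
Proof. by rewrite /flat cl_idem. Qed.

Lemma cl_sub_flat A F : flat M F -> (cl A \subset F) = (A \subset F).
Proof. by move=> /eqP <-; exact: cl_sub. Qed.

Lemma cl0 : loopless M -> cl set0 = set0.
Proof.
move=> lM; apply/setP=> x; rewrite in_cl setU0 rk0 inE.
by have := lM x; lia.
Qed.

End MatroidTheory.

(** * Building sets: factors of a flat, and nested sets *)

Section BuildingSet.
Variables (E : finType) (M : matroid E) (G : {set {set E}}).
Hypotheses (M_loopless : loopless M) (G_building : building_set M G).
Implicit Types A B F H K W : {set E}.
Implicit Types T : {set {set E}}.
Local Notation rk := (rk M).
Local Notation cl := (cl M).

Lemma building_flat F : F \in G -> cl F = F.
Proof. by case: G_building => h _ /h [/eqP]. Qed.

Lemma building_neq0 F : F \in G -> F != set0.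
Proof. by case: G_building => h _ /h []. Qed.

Lemma in_factors W K : K \in maximal_in G W ->
  [/\ K \in G, K \subset W & forall H, H \in G -> H \subset W -> K \subset H -> H = K].
Proof.
rewrite inE => /and3P [KG KW /forallP h]; split=> // H HG HW KH.
by have := h H; rewrite HG HW KH => /eqP.
Qed.

Lemma factor_above W K : K \in G -> K \subset W ->
  exists2 K', K' \in maximal_in G W & K \subset K'.
Proof.
move=> KG KW; pose P K' := [&& K' \in G, K \subset K' & K' \subset W].
have PK : P K by apply/and3P.
case: (arg_maxnP (fun X : {set E} => #|X|) PK) => K' /and3P [K'G KK' K'W] max.
exists K' => //; rewrite inE K'G K'W /=; apply/forallP=> H.
apply/implyP=> HG; apply/implyP=> HW; apply/implyP=> K'H.
rewrite eq_sym eqEcard K'H; apply: max; apply/and3P; split=> //.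
exact: subset_trans KK' K'H.
Qed.

(* The order-reflecting half of the product decomposition of [0, W]. *)
Lemma factor_cl W (A : {set E} -> {set E}) K e : flat M W -> W != set0 ->
    {in maximal_in G W, forall H, A H \subset H} ->
    K \in maximal_in G W -> e \in K ->
  e \in cl (\bigcup_(H in maximal_in G W) A H) -> e \in cl (A K).
Proof.
move=> fW W0 sA KC eK he; case: G_building => _ /(_ W fW W0) [_ _ emb].
pose C := maximal_in G W.
(* [g] differs from [f] only in the coordinate [K], where it adjoins [e]. As [e] already lies in the
   join of [f], the join of [g] is no larger, and the order embedding compares the coordinates at
   [K]. *)
pose f : {ffun {H | H \in C} -> {set E}} := [ffun B => cl (A (val B))].
pose g : {ffun {H | H \in C} -> {set E}} :=
  [ffun B => if val B == K then cl (e |: A K) else cl (A (val B))].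
have flatC H : H \in C -> flat M H by case/in_factors=> HG _ _; apply/eqP/building_flat.
have sf : @in_prod_itv _ M C f.
  move=> B; rewrite ffunE flat_cl; split=> //; rewrite cl_sub_flat; last exact/flatC/valP.
  exact/sA/valP.
have sg : @in_prod_itv _ M C g.
  move=> B; rewrite ffunE; case: eqP => [->|_]; last by have := sf B; rewrite ffunE.
  by rewrite flat_cl cl_sub_flat ?flatC // subUset sub1set eK sA.
have sAf H : H \in C -> A H \subset \bigcup_B f B.
  move=> HC; apply: subset_trans (bigcup_sup (Sub H HC) _) => //.
  by rewrite ffunE; exact: sub_cl.
have [h _] := emb f g sf sg; case: (emb g f sg sf) => {}h _.
have /h /(_ (Sub K KC)) : join_map M g \subset join_map M f.
  rewrite /join_map cl_sub; apply/bigcupsP=> B _; rewrite ffunE.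
  case: eqP => _; last exact/cl_mono/sAf/valP.
  rewrite cl_sub subUset sub1set (subset_trans (sAf _ KC)) ?sub_cl // andbT.
  by apply: (subsetP (cl_mono M _)) he; apply/bigcupsP.
by rewrite !ffunE /= eqxx => /subsetP; apply; apply: (subsetP (sub_cl _ _)); rewrite setU11.
Qed.

(** The surjective half of the decomposition: [W] itself is the join of a family lying below the
    factors. *)
Lemma sub_cl_factors W : flat M W -> W != set0 ->
  W \subset cl (\bigcup_(K in maximal_in G W) K).
Proof.
move=> fW W0; case: G_building => _ /(_ W fW W0) [_ /(_ W fW (subxx _)) [f hf eW] _].
rewrite -{1}eW; apply: cl_mono; apply/bigcupsP=> B _; have [_ h] := hf B.
exact: subset_trans h (bigcup_sup _ (valP B)).
Qed.

(** Otherwise, with [[set e]] in coordinate [H] and the empty set elsewhere, [factor_cl] would put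
    [e] in the closure of the empty set. *)
Lemma factors_disjoint W K H e : flat M W -> W != set0 ->
  K \in maximal_in G W -> H \in maximal_in G W -> e \in K -> e \in H -> K = H.
Proof.
move=> fW W0 KC HC eK eH; apply/eqP/negPn/negP=> KH.
pose A L : {set E} := if L == H then [set e] else set0.
have sA : {in maximal_in G W, forall L : {set E}, A L \subset L}.
  by move=> L _; rewrite /A; case: eqP => [->|_]; rewrite ?sub0set // sub1set.
suff : e \in cl (A K) by rewrite /A (negPf KH) cl0 // inE.
apply: (factor_cl fW W0 sA KC eK); apply: (subsetP (sub_cl _ _)).
by apply/bigcupP; exists H => //; rewrite /A eqxx inE.
Qed.

(** Induction on [#|A|], deleting a point [e] of the factor [K]: by [factor_cl], [e] depends on
    [A :\ e] exactly when it depends on the part of [A :\ e] inside [K], so both sides change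
    together. *)
Lemma rk_factors W A : flat M W -> W != set0 ->
    A \subset \bigcup_(K in maximal_in G W) K ->
  rk A = (\sum_(K in maximal_in G W) rk (A :&: K))%N.
Proof.
move=> fW W0; have [n] := ubnP #|A|; elim: n A => // n IH A; rewrite ltnS => cA sA.
case: (set_0Vmem A) => [->|[e eA]].
  by rewrite rk0 big1 // => K _; rewrite set0I rk0.
have cAe : (#|A :\ e| < n)%N by move: cA; rewrite (cardsD1 e) eA.
have sAe : A :\ e \subset A by exact: subD1set.
have {}IH := IH _ cAe (subset_trans sAe sA).
have /bigcupP [K KC eK] := subsetP sA _ eA.
have AK H : H \in maximal_in G W -> H != K -> A :&: H = (A :\ e) :&: H.
  move=> HC HK; apply/setP=> x; rewrite !inE; case: (x =P e) => // ->.
  case: (boolP (e \in H)); rewrite ?andbF //= => eH.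
  by rewrite (factors_disjoint fW W0 HC KC eH eK) eqxx in HK.
move: IH; rewrite (bigD1 K) //= => IH; rewrite (bigD1 K) //=.
under eq_bigr => H /andP [HC HK] do rewrite AK //.
have eAe : A = e |: (A :\ e) by rewrite setD1K.
have eAK : A :&: K = e |: (A :\ e) :&: K.
  by apply/setP=> x; rewrite !inE; case: (x =P e) => //= ->; rewrite eA eK.
case: (boolP (e \in cl ((A :\ e) :&: K))) => he.
  have he' : e \in cl (A :\ e) := subsetP (cl_mono M (subsetIl _ _)) _ he.
  by move: he he'; rewrite !in_cl -eAe -eAK => /eqP -> /eqP ->; exact: IH.
have he' : e \notin cl (A :\ e).
  apply: contra he => he; apply: (@factor_cl W (fun H => (A :\ e) :&: H)) => //.
    by move=> H _; exact: subsetIr.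
  move: he; apply: (subsetP (cl_mono M _)); apply/subsetP=> x xA.
  have /bigcupP [H HC xH] := subsetP sA _ (subsetP sAe _ xA).
  by apply/bigcupP; exists H => //; rewrite inE xA.
by rewrite eAK [in LHS]eAe !rk_notin_cl // IH addSn.
Qed.

(** The factors of the join that contain [F] and [H] share a point, so they coincide, and this one
    factor is the whole join. *)
Lemma building_join F H : F \in G -> H \in G -> F :&: H != set0 -> cl (F :|: H) \in G.
Proof.
move=> FG HG /set0Pn [e]; rewrite inE => /andP [eF eH].
pose W := cl (F :|: H); have fW : flat M W by exact: flat_cl.
have sW : F :|: H \subset W by exact: sub_cl.
move: (sW); rewrite subUset => /andP [FW HW].
have W0 : W != set0 by apply/set0Pn; exists e; exact: (subsetP FW).
have [K KC FK] := factor_above FG FW; have [L LC HL] := factor_above HG HW.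
have eKL := factors_disjoint fW W0 KC LC (subsetP FK _ eF) (subsetP HL _ eH).
have [KG KW _] := in_factors KC.
suff -> : cl (F :|: H) = K by [].
apply/eqP; rewrite eqEsubset KW andbT cl_sub_flat ?subUset ?FK ?eKL ?HL //.
by apply/eqP; rewrite -eKL building_flat.
Qed.

Lemma nested_sub T T' : T' \subset T -> nested M G T -> nested M G T'.
Proof.
move=> sT /andP [h1 /forallP h2]; rewrite /nested (subset_trans sT h1) /=.
apply/forallP=> X; apply/implyP=> /and3P [sX h3 h4].
by have /implyP := h2 X; apply; rewrite (subset_trans sX sT) h3.
Qed.

Lemma nested_in T F : nested M G T -> F \in T -> F \in G.
Proof. by case/andP=> /subsetP h _ /h; rewrite inE => /andP []. Qed.

Lemma nested_join T T' : nested M G T -> T' \subset T -> (1 < #|T'|)%N ->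
  {in T' &, forall F H, F \subset H -> F = H} -> cl (cover T') \notin G.
Proof.
case/andP=> _ /forallP /(_ T') /implyP h sT c anti; apply: h.
rewrite sT c; apply/forallP=> F; apply/implyP=> FT; apply/forallP=> H; apply/implyP=> HT.
by apply/implyP=> FH; apply/eqP/anti.
Qed.

(** Two incomparable members with a common point would form an antichain whose join is in [G] by
    [building_join]. *)
Lemma nested_meet T F H e : nested M G T -> F \in T -> H \in T -> e \in F -> e \in H ->
  F \subset H \/ H \subset F.
Proof.
move=> nT FT HT eF eH; case: (boolP (F \subset H)); first by left.
case: (boolP (H \subset F)) => [|nHF nFH]; first by right.
have FH : F != H by apply: contra nFH => /eqP ->.
have sT : [set F; H] \subset T by apply/subsetP=> X; rewrite !inE => /orP [] /eqP ->.
have c : (1 < #|[set F; H]|)%N by rewrite cards2 FH.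
suff anti : {in [set F; H] &, forall X Y : {set E}, X \subset Y -> X = Y}.
  have := nested_join nT sT c anti.
  rewrite /cover big_setU1 ?inE //= big_set1 building_join ?(nested_in nT) //.
  by apply/set0Pn; exists e; rewrite inE eF.
move=> X Y; rewrite !inE => /orP [] /eqP -> /orP [] /eqP -> // h.
  by rewrite h in nFH.
by rewrite h in nHF.
Qed.

Lemma sub_cover T F : F \in T -> F \subset cover T.
Proof. by move=> FT; exact: (bigcup_sup F). Qed.

(* The factors of the join of a nested set are its maximal elements. *)
Lemma nested_below_cover T H : nested M G T -> H \in G -> H \subset cl (cover T) ->
  exists2 K, K \in T & H \subset K.
Proof.
move=> nT HG HW; pose W := cl (cover T); have fW : flat M W by exact: flat_cl.
have [e eH] := set0Pn _ (building_neq0 HG).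
have W0 : W != set0 by apply/set0Pn; exists e; exact: (subsetP HW).
have [K KC HK] := factor_above HG HW; have [KG KW _] := in_factors KC.
pose TK := [set L in T | L \subset K].
have sTK : TK \subset T by apply/subsetP=> L; rewrite inE => /andP [].
(* By [factor_cl], since every member of [T] lies below some factor of [W]. *)
have eK : cl (cover TK) = K.
  apply/eqP; rewrite eqEsubset; apply/andP; split.
    rewrite cl_sub_flat; last by apply/eqP/building_flat.
    by apply/bigcupsP=> L; rewrite inE => /andP [].
  apply/subsetP=> x xK; pose A K' := \bigcup_(L in [set L in T | L \subset K']) L.
  apply: (@factor_cl W A) => //.
    by move=> K' _; apply/bigcupsP=> L; rewrite inE => /andP [].
  apply: (subsetP (cl_mono M _)) (subsetP KW _ xK); apply/bigcupsP=> L LT.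
  have [K' K'C LK'] := factor_above (nested_in nT LT) (subset_trans (sub_cover LT) (sub_cl M _)).
  apply: subset_trans (bigcup_sup K' K'C); apply: (bigcup_sup L).
  by rewrite inE LT.
(* The maximal members of [TK] still have join [K], which is in [G]; nestedness excludes two or more
   of them, and looplessness excludes none. *)
pose TM := [set L in TK | [forall L' in TK, (L \subset L') ==> (L == L')]].
have above L : L \in TK -> exists2 L', L' \in TM & L \subset L'.
  move=> LT; pose P L' := (L' \in TK) && (L \subset L').
  have PL : P L by apply/andP.
  case: (arg_maxnP (fun X : {set E} => #|X|) PL) => L' /andP [L'T LL'] max.
  exists L' => //; rewrite inE L'T /=; apply/forallP=> X.
  apply/implyP=> XT; apply/implyP=> L'X; rewrite eqEcard L'X; apply: max.
  by rewrite /P XT (subset_trans LL' L'X).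
have eM : cl (cover TM) = K.
  apply/eqP; rewrite -eK eqEsubset; apply/andP; split; apply: cl_mono.
    by apply/bigcupsP=> L; rewrite inE => /andP [LT _]; exact: sub_cover.
  apply/bigcupsP=> L /above [L' L'T LL']; apply: subset_trans LL' _.
  exact: sub_cover.
have sTM : TM \subset T.
  by apply: subset_trans sTK; apply/subsetP=> L; rewrite inE => /andP [].
have [c|] := ltnP 1 #|TM|.
  suff anti : {in TM &, forall X Y : {set E}, X \subset Y -> X = Y}.
    by have := nested_join nT sTM c anti; rewrite eM KG.
  move=> X Y; rewrite inE => /andP [_ /forallP /(_ Y)]; rewrite -/TK => h.
  rewrite inE => /andP [YT _] XY.
  by apply/eqP; move: h; rewrite YT XY.
case e0: #|TM| => [|[|//]] _.
  have := HK; rewrite -eM (cards0_eq e0) /cover big_set0 cl0 //.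
  by move/subsetP/(_ e eH); rewrite inE.
have /cards1P [L eL] : #|TM| == 1%N by rewrite e0.
have LT : L \in T by apply: (subsetP sTM); rewrite eL inE.
exists L => //; apply: subset_trans HK _.
by rewrite -eM eL /cover big_set1 (building_flat (nested_in nT LT)).
Qed.

(** [H] is a factor of the join of [H |: T] and the members of [T] lie in the other factors, so
    ranks add by [rk_factors]. *)
Lemma rk_nested_split T H A : nested M G (H |: T) ->
    {in T, forall K, ~~ (K \subset H) /\ ~~ (H \subset K)} -> A \subset H ->
  rk (cover T :|: A) = (rk (cover T) + rk A)%N.
Proof.
move=> nTH inc AH; set B := cover T.
have HT : H \in H |: T by rewrite setU11.
have HG := nested_in nTH HT; have [e eH] := set0Pn _ (building_neq0 HG).
pose W := cl (cover (H |: T)); have fW : flat M W by exact: flat_cl.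
have sW K : K \in H |: T -> K \subset W.
  by move=> KT; apply: subset_trans (sub_cover KT) (sub_cl M _).
have W0 : W != set0 by apply/set0Pn; exists e; exact: (subsetP (sW H HT)).
have HC : H \in maximal_in G W.
  rewrite inE HG (sW H HT) /=; apply/forallP=> K; apply/implyP=> KG; apply/implyP=> KW.
  apply/implyP=> HK; have [L] := nested_below_cover nTH KG KW.
  rewrite !inE => /orP [/eqP ->|LT] KL; first by rewrite eqEsubset KL.
  by have [_] := inc L LT; rewrite (subset_trans HK KL).
(* The case [A = H] suffices: by diminishing returns, enlarging [A] to [H] gains no more rank in the
   presence of [B] than without it. *)
suff h : (rk B + rk H <= rk (B :|: H))%N.
  have := rkU_submod M H (subsetUr B A); rewrite (setUidPr AH) -setUA (setUidPr AH).
  by have := rkU_le M B A; have := rkU_submod M B AH; rewrite ![_ :|: B]setUC; move: h; clear; lia.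
have rW : rk (B :|: H) = rk W.
  rewrite rk_cl; congr rk; rewrite /cover big_setU1 /=; first exact: setUC.
  by apply/negP=> /inc []; rewrite subxx.
have -> : rk (B :|: H) = rk (\bigcup_(K in maximal_in G W) K).
  apply/eqP; rewrite rW eqn_leq -(rk_cl M (\bigcup_(K in _) K)) rk_mono ?sub_cl_factors //.
  rewrite rk_cl rk_mono //; apply/bigcupsP=> K KC.
  by case: (in_factors KC).
rewrite (rk_factors fW W0 (subxx _)) (bigD1 H) //= addnC leq_add ?rk_mono //.
  by rewrite subsetI subxx andbT; exact: bigcup_sup.
pose D := \bigcup_(K in maximal_in G W | K != H) K.
have BD : B \subset D.
  apply/bigcupsP=> K KT; have KT' : K \in H |: T by rewrite setU1r.
  have [L LC KL] := factor_above (nested_in nTH KT') (sW K KT').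
  apply: (subset_trans KL); apply: (bigcup_sup L); rewrite LC /=.
  by apply/eqP=> LH; have [] := inc K KT; rewrite -LH KL.
apply: leq_trans (rk_mono M BD) _; apply: leq_trans (rk_bigcup_le _ _ _) _.
apply: leq_sum => K /andP [KC _]; apply: rk_mono.
by rewrite subsetI subxx andbT; exact: bigcup_sup.
Qed.

End BuildingSet.

(** * Nested sets of variables, generic points and rank gains *)

Section NestedVariables.
Variables (E : finType) (M : matroid E) (G : {set {set E}}).
Hypotheses (M_loopless : loopless M) (G_building : building_set M G).
Hypothesis (G_E : [set: E] \in G).
Implicit Types (F H K : gvar G) (S T : {set gvar G}) (P A : {set E}).
Local Notation rk := (rk M).
Local Notation cl := (cl M).

Definition cov S : {set E} := \bigcup_(F in S) val F.

Lemma cover_val S : cover (val @: S) = cov S.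
Proof. by rewrite /cover big_imset //; exact: in2W val_inj. Qed.

Lemma covU1 F S : cov (F |: S) = val F :|: cov S.
Proof.
rewrite /cov; have [FS|FS] := boolP (F \in S); last by rewrite big_setU1.
by rewrite (setUidPr _) ?sub1set //; apply/esym/setUidPr/(bigcup_sup F).
Qed.

Lemma cov0 : cov set0 = set0.
Proof. exact: big_set0. Qed.

Lemma cov_mono S T : S \subset T -> cov S \subset cov T.
Proof. by move=> /subsetP sST; apply/bigcupsP=> F /sST FT; exact: (bigcup_sup F). Qed.

Lemma gvar_in F : val F \in G.
Proof. by have := valP F; rewrite inE => /andP []. Qed.

Lemma nested_var_sub S T : S \subset T -> nested_var M T -> nested_var M S.
Proof. by move=> sST; apply: nested_sub; exact: imsetS. Qed.

Lemma nested_var_meet T F H e : nested_var M T -> F \in T -> H \in T ->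
  e \in val F -> e \in val H -> val F \subset val H \/ val H \subset val F.
Proof.
by move=> nT FT HT; apply: (nested_meet M_loopless G_building nT); exact: imset_f.
Qed.

(** Otherwise [P] would lie below a single member of [T], by [nested_below_cover]. The point [e]
    serves to force an increase of rank. *)
Lemma nested_var_escape T P : nested_var M T -> P \in G ->
  {in T, forall K, ~~ (P \subset val K)} -> exists2 e, e \in P & e \notin cl (cov T).
Proof.
move=> nT PG nP; apply/subsetPn/negP; rewrite -cover_val.
by case/(nested_below_cover M_loopless G_building nT PG) => _ /imsetP [K KT ->]; exact/negP/nP.
Qed.

Lemma gvar_proper F : ~~ ([set: E] \subset val F).
Proof. by have := valP F; rewrite !inE subTset => /andP []. Qed.

Lemma nested_var_proper T : nested_var M T -> exists e, e \notin cl (cov T).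
Proof.
move=> nT; have [|e _ he] := nested_var_escape nT G_E; last by exists e.
by move=> K _; exact: gvar_proper.
Qed.

Lemma rk_cov_lt T : nested_var M T -> (rk (cov T) < rank M)%N.
Proof.
by case/nested_var_proper=> e /rk_notin_cl <-; exact: rk_mono (subsetT _).
Qed.

(** The point is taken outside the closure of those members of [T] that do not contain [P]. *)
Lemma nested_var_generic_pt T P : nested_var M T -> P \in G ->
    (forall K e, K \in T -> e \in P -> e \in val K -> P \subset val K \/ val K \subset P) ->
  exists2 e, e \in P & forall K, K \in T -> e \in val K -> P \subset val K.
Proof.
move=> nT PG cmp; pose T' := [set K in T | ~~ (P \subset val K)].
have sT : T' \subset T by apply/subsetP=> K; rewrite inE => /andP [].
have [|e eP he] := @nested_var_escape T' P (nested_var_sub sT nT) PG.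
  by move=> K; rewrite inE => /andP [].
exists e => // K KT eK; apply: contraR he => nPK; apply: (subsetP (sub_cl M _)).
by apply/bigcupP; exists K => //; rewrite inE KT.
Qed.

Lemma rk_cov_split T F A : nested_var M (F |: T) -> A \subset val F ->
    {in T, forall K, ~~ (val K \subset val F) /\ ~~ (val F \subset val K)} ->
  rk (cov T :|: A) = (rk (cov T) + rk A)%N.
Proof.
move=> nT AF inc; rewrite -cover_val.
apply: (@rk_nested_split _ _ G M_loopless G_building _ (val F)) => //.
  by rewrite -imsetU1.
by move=> _ /imsetP [K KT ->]; exact: inc.
Qed.

(** [T] splits into members below [F] and members incomparable with [F]; the rank of the latter adds
    both to that of [F] and to that of the former. *)
Lemma rk_cov_gain T F : nested_var M (F |: T) -> {in T, forall K, ~~ (val F \subset val K)} ->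
  rk (cov (F |: T)) = (rk (cov T) + rk (val F) - rk (cov [set K in T | val K \subset val F]))%N.
Proof.
move=> nT nF; set T1 := [set K in T | val K \subset val F].
pose T2 := [set K in T | ~~ (val K \subset val F)].
have eT : T = T2 :|: T1.
  by apply/setP=> K; rewrite !inE; case: (K \in T); case: (_ \subset _).
have nT2 : nested_var M (F |: T2) by apply: nested_var_sub nT; rewrite setUS // eT subsetUl.
have inc : {in T2, forall K, ~~ (val K \subset val F) /\ ~~ (val F \subset val K)}.
  by move=> K; rewrite inE => /andP [KT ->]; split=> //; exact: nF.
have s1 : cov T1 \subset val F by apply/bigcupsP=> K; rewrite inE => /andP [].
have eC : cov T = cov T2 :|: cov T1 by rewrite {1}eT /cov bigcup_setU.
rewrite covU1 eC setUC -setUA (setUidPr s1).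
by rewrite (rk_cov_split nT2 s1) // (rk_cov_split nT2 (subxx _)) //; clear; lia.
Qed.

(* The exponent of a later factor only changes when the new element lies below it. *)
Lemma rk_cov_gain_indep T F H : nested_var M (H |: (F |: T)) ->
    {in T, forall K, ~~ (val F \subset val K)} ->
    {in F |: T, forall K, ~~ (val H \subset val K)} -> ~~ (val F \subset val H) ->
  (rk (cov (H |: (F |: T))) - rk (cov (F |: T)) = rk (cov (H |: T)) - rk (cov T))%N.
Proof.
move=> nT nF nH FH.
have nHT : nested_var M (H |: T) by apply: nested_var_sub nT; rewrite setUS // subsetUr.
rewrite (rk_cov_gain nT nH) (rk_cov_gain nHT); last by move=> K KT; apply: nH; rewrite setU1r.
have -> : [set K in F |: T | val K \subset val H] = [set K in T | val K \subset val H].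
  by apply/setP=> K; rewrite !inE; case: (K =P F) => // ->; rewrite (negPf FH) !andbF.
have : (rk (cov [set K in T | val K \subset val H]) <= rk (val H))%N.
  by apply: rk_mono; apply/bigcupsP=> K; rewrite inE => /andP [].
by clear; lia.
Qed.

End NestedVariables.

(** * Expansion of a single factor of the Chern class *)

Section BlowupFactor.
Variables (R : comNzRingType) (theta v x : R) (Q : R -> Prop).
Hypothesis v_inv : (1 + (theta + x)) * v = 1.
Hypothesis Q_opp : Q (- v).
Hypothesis Q_mul : forall c, Q c -> Q (c * v).
Hypothesis Q_pow : forall m n, Q (v ^+ m *+ n).

(** Coefficients are known only through [Q], later taken to be [liftsp]: the dimension count needs
    the power of [theta] and the degree of its coefficient, nothing else. *)
Inductive low_degree : nat -> R -> Prop :=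
  | LowDegree0 m : low_degree m 0
  | LowDegreeX a m c of (a < m)%N & Q c : low_degree m (theta ^+ a * c)
  | LowDegreeD m y z of low_degree m y & low_degree m z : low_degree m (y + z).

Lemma low_degree_mul m y : low_degree m y -> low_degree m.+1 (y * ((1 + theta) * v)).
Proof.
elim=> {m y} [m|a m c am Qc|m y z _ IHy _ IHz].
- by rewrite mul0r; exact: LowDegree0.
- have -> : theta ^+ a * c * ((1 + theta) * v) =
            theta ^+ a * (c * v) + theta ^+ a.+1 * (c * v) by rewrite exprS; ring.
  by apply: LowDegreeD; apply: LowDegreeX; rewrite ?ltnS ?(ltnW am) //; exact: Q_mul.
- by rewrite mulrDl; exact: LowDegreeD.
Qed.

(* The coefficient m of theta^m is the Euler characteristic m + 1 of the exceptional
   projective space minus that of the blown-up point. *)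
Lemma blowup_factor m : exists2 L, low_degree m L &
  (1 + x) * ((1 + theta) * v) ^+ m.+1 =
  1 + x * (L + theta ^+ m * v ^+ m.+1 *+ m + theta ^+ m.+1 * v ^+ m.+1).
Proof.
have e1 : (1 + theta) * v = 1 - x * v by rewrite -[in RHS]v_inv; ring.
elim: m => [|m [L hL e]].
  exists 0; first exact: LowDegree0.
  rewrite !expr1 expr0 mulr0n !add0r.
  have -> : (1 + x) * ((1 + theta) * v) = (1 + (theta + x)) * v + x * (theta * v) by ring.
  by rewrite v_inv.
(* Multiplication by [(1 + theta) * v = 1 - x * v] creates [- v]. The old [m]-fold term gives the
   last summand here and [m] copies of the next power of [theta]; the old top term supplies one more
   copy. *)
exists (theta ^+ 0 * - v + L * ((1 + theta) * v) + theta ^+ m * (v ^+ m.+2 *+ m)).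
  apply: LowDegreeD; last by apply: LowDegreeX.
  by apply: LowDegreeD; [exact: LowDegreeX | exact: low_degree_mul].
have e2 g : (1 + x * g) * ((1 + theta) * v) = 1 + x * (- v + g * ((1 + theta) * v)).
  by rewrite [LHS]mulrDl mul1r {1}e1; ring.
rewrite exprSr mulrA e e2 expr0 mulrSr !exprS; congr (1 + x * _).
by ring.
Qed.

End BlowupFactor.

Lemma mul_factor_id (R : comNzRingType) (y z w : R) n :
  y * z = 0 -> y * ((1 + z) * (1 - z * w) ^+ n) = y.
Proof.
move=> yz; have yzw : y * (1 - z * w) = y by rewrite mulrBr mulr1 mulrA yz mul0r subr0.
rewrite mulrA mulrDr mulr1 yz addr0.
by elim: n => [|n IH]; rewrite ?expr0 ?mulr1 // exprS mulrA yzw.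
Qed.

Lemma mul_prod_congr (R : comNzRingType) (I : eqType) (s : seq I) (y : R) (f g : I -> R) :
  {in s, forall i, y * f i = y * g i} -> y * \prod_(i <- s) f i = y * \prod_(i <- s) g i.
Proof.
elim: s => [|i s IH] h; first by rewrite !big_nil.
rewrite !big_cons !mulrA h ?inE ?eqxx // mulrAC IH => [|j js]; first by rewrite mulrAC.
by rewrite h // inE js orbT.
Qed.

Lemma coef_line_series_exp (A : comNzRingType) (D : A) n j :
  (line_series D ^+ n)`_j = D ^+ j *+ 'C(n, j).
Proof.
rewrite /line_series exprDn coef_sum.
under eq_bigr => i _ do rewrite expr1n mul1r exprZn coefMn coefZ coefXn.
case: (ltnP j n.+1) => jn.
  rewrite (bigD1 (Sub j jn : 'I_n.+1)) //= eqxx mulr1 big1 ?addr0 // => i ij.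
  by rewrite -val_eqE eq_sym /= in ij; rewrite (negPf ij) mulr0 mul0rn.
rewrite bin_small // big1 // => i _.
by rewrite gtn_eqF ?mulr0 ?mul0rn // (leq_trans (ltn_ord i)).
Qed.

(** * Vanishing and degree counts from the Chow ring relations *)

Section ChowAlgebra.
Variables (E : finType) (M : matroid E) (G : {set {set E}}).
Hypotheses (M_loopless : loopless M) (G_building : building_set M G).
Hypothesis (G_E : [set: E] \in G).
Variables (A : comNzRingType) (x : gvar G -> A) (e0 : E).
Hypothesis x_nonnested : forall S : {set gvar G}, ~~ nested_var M S -> \prod_(F in S) x F = 0.
Hypothesis x_linear : forall e f : E,
  \sum_(F : gvar G | e \in val F) x F = \sum_(F : gvar G | f \in val F) x F.
Implicit Types (F H K : gvar G) (S T : {set gvar G}) (P : {set E}) (y z D : A).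
Local Notation rk := (rk M).
Local Notation cl := (cl M).

Definition xprod S : A := \prod_(F in S) x F.
Definition al : A := \sum_(F : gvar G | e0 \in val F) x F.
Definition xi F : A := al - \sum_(H : gvar G | val F \proper val H) x H.
Definition th F : A := al - \sum_(H : gvar G | val F \subset val H) x H.

Lemma xprodU1 F S : F \notin S -> xprod (F |: S) = x F * xprod S.
Proof. exact: big_setU1. Qed.

Lemma xprod0 S : ~~ nested_var M S -> xprod S = 0.
Proof. exact: x_nonnested. Qed.

Lemma x_xprod0 F S : ~~ nested_var M (F |: S) -> x F * xprod S = 0.
Proof.
move=> nn; have [FS|FS] := boolP (F \in S); last by rewrite -xprodU1 // xprod0.
by rewrite xprod0 ?mulr0 //; move: nn; rewrite (setUidPr _) ?sub1set.
Qed.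

Lemma xx0 F H e : e \in val F -> e \in val H ->
  ~~ (val F \subset val H) -> ~~ (val H \subset val F) -> x F * x H = 0.
Proof.
move=> eF eH nFH nHF; have -> : x H = xprod [set H] by rewrite /xprod big_set1.
apply: x_xprod0; apply/negP=> nT.
have FT : F \in [set F; H] by rewrite !inE eqxx.
have HT : H \in [set F; H] by rewrite !inE eqxx orbT.
have [] := nested_var_meet M_loopless G_building nT FT HT eF eH; exact/negP.
Qed.

Lemma alE e : al = \sum_(F : gvar G | e \in val F) x F.
Proof. exact: x_linear. Qed.

(** Every set containing [P] contains [e], so this is [al] expanded at [e] with those terms removed.
    The right side is independent of [e], so points of [P] may be chosen or exchanged freely. *)
Lemma sum_avoid P e : e \in P ->
  \sum_(H : gvar G | (e \in val H) && ~~ (P \subset val H)) x H =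
  al - \sum_(H : gvar G | P \subset val H) x H.
Proof.
move=> eP; apply/eqP; rewrite eq_sym subr_eq; apply/eqP.
rewrite (alE e) (bigID (fun H : gvar G => P \subset val H)) addrC; congr (_ + _).
by apply: eq_bigl => H; apply: andb_idl => /subsetP; apply.
Qed.

Lemma xiE F : xi F = th F + x F.
Proof.
rewrite /xi /th [in RHS](bigD1 F) //= opprD addrA addrAC subrK.
by congr (al - _); apply: eq_bigl => H; rewrite properEneq andbC eq_sym.
Qed.

(** Expand one [al] at a point outside [cl (cov S)]: each variable that appears is new and raises
    the rank of [cov S]. At [a = 0] the set [S] cannot be nested, by [rk_cov_lt]. *)
Lemma xprod_al_eq0 S a : (rank M <= a + rk (cov S))%N -> xprod S * al ^+ a = 0.
Proof.
elim: a S => [|a IH] S ha; have [nS|/xprod0 ->] := boolP (nested_var M S); rewrite ?mul0r //.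
  by have := rk_cov_lt M_loopless G_building G_E nS; lia.
have [e he] := nested_var_proper M_loopless G_building G_E nS.
rewrite exprS mulrA {1}(alE e) mulr_sumr mulr_suml big1 // => H eH.
have HS : H \notin S.
  by apply: contra he => HS; apply: (subsetP (sub_cl _ _)); apply/bigcupP; exists H.
rewrite [_ * x H]mulrC -xprodU1 // IH //.
have := rk_notin_cl he; have := @rk_mono _ M (e |: cov S) (cov (H |: S)).
rewrite covU1 => h; have {h} := h _; rewrite setSU ?sub1set // => /(_ isT).
by move: ha; clear; lia.
Qed.

(** Expand one [th F] at a point of [F] outside [cl (cov S)]: each [H] that appears does not contain
    [F], and adjoining it shrinks the rank gap between [S] and [F |: S]. *)
Lemma xprod_th_eq0 S F a : {in S, forall K, ~~ (val F \subset val K)} ->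
  (rk (cov (F |: S)) <= a + rk (cov S))%N -> xprod S * th F ^+ a = 0.
Proof.
elim: a S => [|a IH] S nF ha; have [nS|/xprod0 ->] := boolP (nested_var M S); rewrite ?mul0r //;
  have [e eF he] := nested_var_escape M_loopless G_building nS (gvar_in F) nF.
  have := rk_notin_cl he; have := @rk_mono _ M (e |: cov S) (cov (F |: S)).
  rewrite covU1 setSU ?sub1set // => /(_ isT).
  by move: ha; rewrite covU1; clear; lia.
rewrite exprS mulrA {1}/th -(sum_avoid eF) mulr_sumr mulr_suml big1 // => H /andP [eH nFH].
have HS : H \notin S.
  by apply: contra he => HS; apply: (subsetP (sub_cl _ _)); apply/bigcupP; exists H.
rewrite [_ * x H]mulrC -xprodU1 // IH //.
  by move=> K; rewrite !inE => /orP [/eqP ->|/nF].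
have sU : e |: cov S \subset cov (H |: S) by rewrite covU1 setSU ?sub1set.
have := rkU_submod M (val F) sU; have := rk_notin_cl he.
have -> : e |: cov S :|: val F = cov (F |: S).
  by rewrite setUAC covU1; congr (_ :|: _); apply/setUidPr; rewrite sub1set.
have -> : cov (H |: S) :|: val F = cov (F |: (H |: S)) by rewrite !covU1 setUC.
by move: ha; clear; lia.
Qed.

(* [extspan S m] is the span of the monomials x_T obtained from x_S by adjoining m
   variables x_H with H not below any element of S; it vanishes for m >= r - rk (join S). *)
Definition outside S H := {in S, forall K, ~~ (val H \subset val K)}.

Inductive extspan S : nat -> A -> Prop :=
  | Extspan0 m : extspan S m 0
  | ExtspanX T m of S \subset T & (forall H, H \in T -> H \notin S -> outside S H)
      & #|T| = (#|S| + m)%N : extspan S m (xprod T)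
  | ExtspanD m y z of extspan S m y & extspan S m z : extspan S m (y + z)
  | ExtspanN m y of extspan S m y : extspan S m (- y).

Lemma extspan_sum (I : finType) (Q : pred I) (f : I -> A) S m :
  (forall i, Q i -> extspan S m (f i)) -> extspan S m (\sum_(i | Q i) f i).
Proof.
by move=> h; apply: big_ind => // [|y z]; [exact: Extspan0 | exact: ExtspanD].
Qed.

(** New elements are removed from the largest on. The one removed lies below no other element of
    [T], so it has a point outside the closure of the rest and accounts for at least one unit of
    rank. *)
Lemma card_outside_le S T : nested_var M T -> S \subset T ->
    (forall H, H \in T -> H \notin S -> outside S H) ->
  (#|T :\: S| + rk (cov S) <= rk (cov T))%N.
Proof.
have [n] := ubnP #|T :\: S|; elim: n T => // n IH T; rewrite ltnS => cT nT sST oT.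
have [e|[H0 H0T]] := set_0Vmem (T :\: S).
  by rewrite e cards0 add0n rk_mono // cov_mono.
pose new H := (H \notin S) && (H \in T).
have H0new : new H0 by move: H0T; rewrite inE.
case: (arg_maxnP (fun H => #|val H|) H0new) => H /andP [HS HT] max.
pose T' := T :\ H; have sT' : T' \subset T := subD1set _ _.
have sST' : S \subset T' by rewrite subsetD1 sST HS.
have eD : T :\: S = H |: (T' :\: S).
  by apply/setP=> K; rewrite !inE; case: (K =P H) => // ->; rewrite HS HT.
have HD : H \notin T' :\: S by rewrite !inE eqxx andbF.
have cD : #|T :\: S| = (#|T' :\: S|).+1 by rewrite eD cardsU1 HD.
have nH : {in T', forall K, ~~ (val H \subset val K)}.
  move=> K; rewrite !inE => /andP [KH KT]; have [KS|KS] := boolP (K \in S).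
    exact: oT HT HS _ KS.
  apply/negP=> HK; have Knew : new K by rewrite /new KS.
  have /eqP/val_inj e : val H == val K by rewrite eqEcard HK; exact: max.
  by rewrite e eqxx in KH.
have [e eH he] := nested_var_escape M_loopless G_building (nested_var_sub sT' nT) (gvar_in H) nH.
have := IH T' _ (nested_var_sub sT' nT) sST'.
rewrite -ltnS -cD ltnS => /(_ cT).
have oT' K : K \in T' -> K \notin S -> outside S K by move=> /(subsetP sT'); exact: oT.
move=> /(_ oT'); have := rk_notin_cl he.
have := @rk_mono _ M (e |: cov T') (cov T).
rewrite subUset sub1set cov_mono // andbT (subsetP (bigcup_sup H HT)) // => /(_ isT).
by move: cD; clear; lia.
Qed.

(** A nested monomial with [m] new variables would have rank at least [m + rk (cov S)], against
    [rk_cov_lt]. *)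
Lemma extspan_eq0 S m y : extspan S m y -> (rank M <= m + rk (cov S))%N -> y = 0.
Proof.
elim=> {m y} [//|T m sST oT cT h|m y z _ IHy _ IHz h|m y _ IHy h].
- apply: xprod0; apply/negP=> nT.
  have := card_outside_le nT sST oT; have := rk_cov_lt M_loopless G_building G_E nT.
  by rewrite cardsD (setIidPr sST); lia.
- by rewrite IHy // IHz // addr0.
- by rewrite IHy // oppr0.
Qed.

(** [P] is the smallest member of [T] strictly above [H], or [[set: E]] if there is none; members of
    [T] through a point of [H] form a chain. *)
Lemma nested_var_parent T H : nested_var M T -> H \in T ->
  exists P, [/\ P \in G, val H \proper P,
    forall K e, K \in T -> e \in P -> e \in val K -> P \subset val K \/ val K \subset P
  & forall K, K \in T -> val H \proper val K -> P \subset val K].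
Proof.
move=> nT HT; pose above K := (K \in T) && (val H \proper val K).
have [e eH] : exists e, e \in val H by apply/set0Pn/(building_neq0 G_building)/gvar_in.
have [K0 hK0|none] := pickP above; last first.
  exists [set: E]; split=> // [|K e' _ _ _|K KT HK]; last by move: (none K); rewrite /above KT HK.
    by rewrite properT; apply/eqP=> HE; have := gvar_proper H; rewrite HE subxx.
  by right; exact: subsetT.
case: (arg_minnP (fun K => #|val K|) hK0) => K /andP [KT HK] min.
exists (val K); split=> // [|L e' LT eK eL|L LT HL]; first exact: gvar_in.
  exact: nested_var_meet nT KT LT eK eL.
have [eK eL] : e \in val K /\ e \in val L.
  by split; apply: (subsetP (proper_sub _)) eH.
have [//|LK] := nested_var_meet M_loopless G_building nT KT LT eK eL.
have : val L == val K by rewrite eqEcard LK; apply: min; rewrite /above LT.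
by move=> /eqP ->.
Qed.

(* For H in T, the relation between a generic point of H and a generic point of the
   smallest element of T above H (or of E) expresses x_H x_T through squarefree monomials. *)
Lemma extspan_mulx S H m y : outside S H -> extspan S m y -> extspan S m.+1 (x H * y).
Proof.
move=> oH; elim=> {m y} [m|T m sST oT cT|m y z _ IHy _ IHz|m y _ IHy]; last 2 first.
- by rewrite mulrDr; exact: ExtspanD.
- by rewrite mulrN; exact: ExtspanN.
- by rewrite mulr0; exact: Extspan0.
have new K : K \notin T -> outside S K -> extspan S m.+1 (x K * xprod T).
  move=> KT oK; rewrite -xprodU1 //; apply: ExtspanX; first exact: subset_trans sST (subsetUr _ _).
    by move=> L; rewrite !inE => /orP [/eqP -> //|]; exact: oT.
  by rewrite cardsU1 KT cT; lia.
have [HT|HT] := boolP (H \in T); last exact: new.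
have [nT|/xprod0 ->] := boolP (nested_var M T); last by rewrite mulr0; exact: Extspan0.
have [P [PG HP cmpP minP]] := nested_var_parent nT HT.
have [i iH hi] : exists2 e, e \in val H & forall K, K \in T -> e \in val K -> val H \subset val K.
  apply: (nested_var_generic_pt M_loopless G_building nT (gvar_in H)) => K e KT eH eK.
  exact: nested_var_meet nT HT KT eH eK.
have [j jP hj] := nested_var_generic_pt M_loopless G_building nT PG cmpP.
have iP : i \in P by apply: (subsetP (proper_sub HP)).
(* Both sums equal [al] minus the variables above [P]. The one at [i] contains [x H], which is
   isolated; genericity of [i] and [j] makes all other variables new and outside [S]. *)
have := etrans (sum_avoid iP) (esym (sum_avoid jP)).
rewrite (bigD1 H) /=; last by rewrite iH; case/properP: HP => _ [e eP eH]; apply/subsetPn; exists e.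
move/(canRL (addrK _)) => ->; rewrite mulrBl !mulr_suml.
apply: ExtspanD; last apply: ExtspanN; apply: extspan_sum => K.
  move=> /andP [jK nPK]; apply: new; first by apply: contra nPK => /hj; exact.
  move=> L LS; apply/negP=> KL; have LT := subsetP sST _ LS.
  have := hj L LT (subsetP KL _ jK) => PL; have := oH L LS.
  by rewrite (subset_trans (proper_sub HP) PL).
move=> /andP [/andP [iK nPK] KH]; apply: new.
  apply: contra nPK => KT; apply: minP => //.
  by rewrite properEneq hi // andbT eq_sym.
move=> L LS; apply/negP=> KL; have LT := subsetP sST _ LS.
by have := oH L LS; rewrite hi // (subsetP KL _ iK).
Qed.

(* "y has degree at least j in the variables outside S", in a form stable under products. *)
Definition lifts S j y := forall m z, extspan S m z -> extspan S (m + j) (y * z).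

Lemma lifts0 S j : lifts S j 0.
Proof. by move=> m z _; rewrite mul0r; exact: Extspan0. Qed.

Lemma lifts1 S : lifts S 0 1.
Proof. by move=> m z hz; rewrite addn0 mul1r. Qed.

Lemma liftsD S j y y' : lifts S j y -> lifts S j y' -> lifts S j (y + y').
Proof. by move=> h h' m z hz; rewrite mulrDl; apply: ExtspanD; [exact: h | exact: h']. Qed.

Lemma liftsN S j y : lifts S j y -> lifts S j (- y).
Proof. by move=> h m z hz; rewrite mulNr; apply: ExtspanN; exact: h. Qed.

Lemma liftsM S j k y y' : lifts S j y -> lifts S k y' -> lifts S (j + k) (y * y').
Proof. by move=> h h' m z hz; rewrite -mulrA addnA addnAC; apply: h; exact: h'. Qed.

Lemma lifts_sum (I : finType) (Q : pred I) (f : I -> A) S j :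
  (forall i, Q i -> lifts S j (f i)) -> lifts S j (\sum_(i | Q i) f i).
Proof. by move=> h; apply: big_ind => //; [exact: lifts0 | exact: liftsD]. Qed.

Lemma lifts_x S H : outside S H -> lifts S 1 (x H).
Proof. by move=> oH m z hz; rewrite addn1; exact: extspan_mulx. Qed.

Lemma liftsX S y n : lifts S 1 y -> lifts S n (y ^+ n).
Proof.
move=> h; elim: n => [|n IH]; first by rewrite expr0; exact: lifts1.
by rewrite exprS -add1n; exact: liftsM.
Qed.

Lemma lifts_al S : nested_var M S -> lifts S 1 al.
Proof.
move=> nS; have [e he] := nested_var_proper M_loopless G_building G_E nS.
rewrite (alE e); apply: lifts_sum => H eH; apply: lifts_x => K KS.
apply: contra he => /subsetP HK; apply: (subsetP (sub_cl _ _)).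
by apply/bigcupP; exists K => //; exact: HK.
Qed.

Lemma lifts_xi S F : nested_var M S -> (forall H, val F \proper val H -> outside S H) ->
  lifts S 1 (xi F).
Proof.
move=> nS oF; apply: liftsD; first exact: lifts_al.
by apply: liftsN; apply: lifts_sum => H /oF; exact: lifts_x.
Qed.

(** [xprod S] lies in [extspan S 0], so its product with [y] lies in [extspan S j], which is zero in
    this range. *)
Lemma lifts_eq0 S j y : lifts S j y -> (rank M <= j + rk (cov S))%N -> xprod S * y = 0.
Proof.
move=> h r; rewrite mulrC; apply: (@extspan_eq0 S (0 + j)) => //; apply: h.
by apply: ExtspanX => // [H -> //|]; rewrite addn0.
Qed.

(** Every variable is outside the empty set, so this power has degree [rank M] and vanishes. *)
Lemma xi_nilp F : xi F ^+ rank M = 0.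
Proof.
have -> : xi F ^+ rank M = xprod set0 * xi F ^+ rank M by rewrite /xprod big_set0 mul1r.
apply: lifts_eq0; last exact: leq_addr.
apply: liftsX; apply: lifts_xi => [|H _ K]; last by rewrite inE.
exact: nested_var0.
Qed.

(** Against [y], the variable [x F] acts as [al - th F]. The part with [th F ^+ n.+1] vanishes, and
    in the other part every [th F] may be replaced by [al]. *)
Lemma xprod_th_al S F n b : nested_var M (F |: S) -> outside S F ->
    rk (cov (F |: S)) = (rk (cov S) + n.+1)%N -> rank M = (b + rk (cov (F |: S))).+1 ->
  xprod S * (x F * th F ^+ n) * al ^+ b = xprod S * al ^+ (b + n.+1).
Proof.
move=> nT oF en eb; pose y := xprod S * al ^+ b.
have FS : F \notin S by apply/negP=> /oF; rewrite subxx.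
(* Any [H] strictly above [F] has a point outside the closure of [cov (F |: S)], so [y * x H]
   vanishes by rank. *)
have yx : y * x F = y * (al - th F).
  rewrite /th subKr (bigD1 F) // mulrDr [X in _ + X]mulr_sumr [X in _ + X]big1 ?addr0 //.
  move=> H /andP [FH HF]; have HS : H \notin S by apply/negP=> /oF; rewrite FH.
  rewrite /y mulrAC [_ * x H]mulrC -xprodU1 // xprod_al_eq0 //.
  have [e eH he] : exists2 e, e \in val H & e \notin cl (cov (F |: S)).
    apply: (nested_var_escape M_loopless G_building nT (gvar_in H)) => K.
    rewrite !inE => /orP [/eqP ->|KS].
      by apply: contra HF => HF; rewrite -val_eqE eqEsubset HF.
    by apply: contra (oF K KS); exact: subset_trans.
  have sU : e |: cov (F |: S) \subset cov (H |: S).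
    rewrite !covU1 !subUset sub1set in_setU eH subsetUr andbT /=.
    exact: subset_trans FH (subsetUl _ _).
  by move: (rk_notin_cl he) (rk_mono M sU) eb; clear; lia.
have yax : y * x F * al = 0.
  have -> : y * x F * al = xprod (F |: S) * al ^+ b.+1.
    by rewrite xprodU1 // exprS /y; ring.
  rewrite xprod_al_eq0 //.
  by move: eb; clear; lia.
have yth : y * th F ^+ n.+1 = 0.
  by rewrite /y mulrAC xprod_th_eq0 ?mul0r // en; clear; lia.
(* From [y * (al - th F) * al = 0]. *)
have yath j : y * al * th F ^+ j = y * al ^+ j.+1.
  elim: j => [|j IH]; first by rewrite expr0 mulr1 expr1.
  move: yax; rewrite yx mulrBr mulrBl => /eqP; rewrite subr_eq0 => /eqP e.
  by rewrite exprS mulrA (mulrAC y) -e -mulrA (mulrC al) mulrA -/y mulrAC IH -mulrA -exprSr.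
have -> : xprod S * (x F * th F ^+ n) * al ^+ b = y * x F * th F ^+ n by rewrite /y; ring.
rewrite yx mulrBr mulrBl -[y * th F * _]mulrA -exprS yth subr0 yath.
by rewrite /y -mulrA -exprD.
Qed.

(** * Polynomials in t graded by the degree outside [S] *)

Definition liftsp S (p : {poly A}) := forall j, lifts S j p`_j.

Lemma liftspD S p q : liftsp S p -> liftsp S q -> liftsp S (p + q).
Proof. by move=> hp hq j; rewrite coefD; exact: liftsD. Qed.

Lemma liftspN S p : liftsp S p -> liftsp S (- p).
Proof. by move=> hp j; rewrite coefN; exact: liftsN. Qed.

Lemma liftsp1 S : liftsp S 1.
Proof. by case=> [|j]; rewrite coef1 /=; [exact: lifts1 | exact: lifts0]. Qed.

Lemma liftsp0 S : liftsp S 0.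
Proof. by move=> j; rewrite coef0; exact: lifts0. Qed.

Lemma liftspM S p q : liftsp S p -> liftsp S q -> liftsp S (p * q).
Proof.
move=> hp hq j; rewrite coefM; apply: lifts_sum => i _.
by have := liftsM (hp i) (hq (j - i)%N); rewrite subnKC // -ltnS.
Qed.

Lemma liftsp_exp S p n : liftsp S p -> liftsp S (p ^+ n).
Proof.
by move=> hp; elim: n => [|n IH]; rewrite ?expr0 ?exprS; [exact: liftsp1 | exact: liftspM].
Qed.

Lemma liftspMn S p n : liftsp S p -> liftsp S (p *+ n).
Proof.
by move=> hp; elim: n => [|n IH]; rewrite ?mulr0n ?mulrS; [exact: liftsp0 | exact: liftspD].
Qed.

Lemma liftspZX S D : lifts S 1 D -> liftsp S (D *: 'X).
Proof.
by move=> hD [|[|j]]; rewrite coefZ coefX ?mulr0 ?mulr1 //=; exact: lifts0.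
Qed.

Lemma liftsp_line S D : lifts S 1 D -> liftsp S (line_series D).
Proof. by move=> hD; apply: liftspD; [exact: liftsp1 | exact: liftspZX]. Qed.

Lemma liftsp_line_inv S n D : lifts S 1 D -> liftsp S (line_series_inv n D).
Proof.
move=> hD; apply: (big_ind (liftsp S)) => [|p q|j _]; [exact: liftsp0 | exact: liftspD |].
exact/liftsp_exp/liftspZX/liftsN.
Qed.

(** * The fractions [u] and their telescoping product *)

Variable (d : nat).
Hypothesis rank_d : rank M = d.+1.

Definition v F : {poly A} := line_series_inv d (xi F).
Definition u F : {poly A} := line_series (th F) * v F.

(** The geometric series truncated at degree [d] is an exact inverse because [xi F ^+ d.+1 = 0]; the
    expansion below can thus take place in [{poly A}] itself. *)
Lemma line_xi_v F : line_series (xi F) * v F = 1.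
Proof.
have -> : line_series (xi F) = 1 - (- xi F *: 'X) by rewrite scaleNr opprK.
rewrite -[LHS]opprK -mulNr opprB -subrX1 exprZn exprNn -rank_d.
by rewrite xi_nilp mulr0 scale0r sub0r opprK.
Qed.

Lemma uE F : u F = 1 - x F *: 'X * v F.
Proof.
rewrite /u -[in RHS](line_xi_v F) -mulrBl xiE /line_series [in RHS]scalerDl.
by congr (_ * _); ring.
Qed.

(* The flats of G above F that occur in a common nonzero monomial form a chain, along
   which the product of the fractions u telescopes. *)
Lemma line_al_prod_u (l : seq (gvar G)) F : uniq l ->
    pairwise (fun H K => ~~ (val K \subset val H)) l ->
    (forall H K, H \in l -> val H \proper val K -> K \in l) ->
  line_series al * \prod_(H <- l | val F \proper val H) u H =
  line_series (al - \sum_(H <- l | val F \proper val H) x H).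
Proof.
elim: l => [|H l IH]; first by rewrite !big_nil mulr1 subr0.
rewrite cons_uniq pairwise_cons => /andP [Hl ul] /andP [/allP pl Pl] up.
have up' (K L : gvar G) : K \in l -> val K \proper val L -> L \in l.
  move=> Kl KL; have := up K L; rewrite !inE Kl orbT => /(_ isT KL) /orP [/eqP e|//].
  by have := pl K Kl; rewrite -e proper_sub.
have {}IH := IH ul Pl up'; rewrite !big_cons; case: ifP => // FH.
rewrite mulrCA IH; set s := \sum_(_ <- _ | _) _.
(* Since [u H = 1 - x H *: 'X * v H], this identity lets [line_series (xi H)] replace the partial
   product and cancel [v H]. It holds because [x H] kills [x K] for [K] above [F] but incomparable
   with [H]. *)
suff xs : x H * (al - s) = x H * xi H.
  have xls : x H *: 'X * line_series (al - s) = x H *: 'X * line_series (xi H).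
    by rewrite /line_series !mulrDr -!scalerAl -!scalerAr !scalerA xs.
  rewrite uE mulrBl mul1r mulrAC xls -mulrA line_xi_v mulr1.
  by rewrite /line_series -addrA -scalerBl; congr (1 + _ *: _); ring.
rewrite /xi !mulrBr; congr (_ - _); rewrite /s !mulr_sumr.
rewrite (bigID (fun K => val H \proper val K)) /= [X in _ + X]big1_seq ?addr0.
  rewrite -big_filter big_uniq ?filter_uniq //; apply: eq_bigl => K.
  rewrite mem_filter; case: (boolP (val H \proper val K)) => HK; last by rewrite andbF.
  rewrite (proper_trans FH HK); have := up H K; rewrite !inE eqxx => /(_ isT HK).
  by move=> /orP [/eqP e|//]; rewrite e properxx in HK.
move=> K /andP [/andP [FK nHK] Kl].
have [e eF] : exists e, e \in val F by apply/set0Pn/(building_neq0 G_building)/gvar_in.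
have KH : ~~ (val K \subset val H) := pl K Kl.
apply: (@xx0 _ _ e); rewrite ?(subsetP (proper_sub FH)) ?(subsetP (proper_sub FK)) //.
by apply: contra nHK => HK; rewrite properE HK.
Qed.

(** * Expansion of the Chern series, one flat at a time *)

Definition factor S H : {poly A} :=
  (1 + x H *: 'X) * u H ^+ (rk (cov (H |: S)) - rk (cov S)).

(** The contribution of a choice [S] with the flats of [l] still to be expanded. The intended [m] is
    the product of the [x F * th F ^+ (n_F - 1)], of degree [rk (cov S)], whence the power of
    ['X]. *)
Definition partial_series S (m : A) (l : seq (gvar G)) : {poly A} :=
  m *: 'X^(rk (cov S)) *
  (line_series al ^+ (rank M - rk (cov S)) * \prod_(H <- l) factor S H).

Lemma factor_id S H (y : {poly A}) : y * (x H *: 'X) = 0 -> y * factor S H = y.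
Proof. by move=> yx; rewrite /factor uE mul_factor_id. Qed.

Lemma rk_cov_nested_lt S F : nested_var M S -> outside S F ->
  (rk (cov S) < rk (cov (F |: S)))%N.
Proof.
move=> nS oF.
have [e eF /rk_notin_cl <-] := nested_var_escape M_loopless G_building nS (gvar_in F) oF.
by apply: rk_mono; rewrite covU1 setSU ?sub1set.
Qed.

Definition increasing (l : seq (gvar G)) :=
  [/\ uniq l, pairwise (fun H K => ~~ (val K \subset val H)) l
    & forall H K, H \in l -> val H \proper val K -> K \in l].

Lemma increasing_cons F l : increasing (F :: l) ->
  [/\ increasing l, F \notin l, {in l, forall H, ~~ (val H \subset val F)}
    & forall H, val F \proper val H -> H \in l].
Proof.
case; rewrite cons_uniq pairwise_cons => /andP [Fl ul] /andP [/allP pl Pl] up.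
have up' (K L : gvar G) : K \in F :: l -> val K \proper val L -> L \in l.
  move=> Kl KL; have := up K L Kl KL; rewrite inE => /orP [/eqP e|//].
  move: Kl; rewrite inE => /orP [/eqP eK|/pl]; first by move: KL; rewrite e eK properxx.
  by rewrite -e proper_sub.
split=> //; last by move=> H; apply: up'; rewrite inE eqxx.
by split=> // K L Kl; apply: up'; rewrite inE Kl orbT.
Qed.

(** The power [v F ^+ n] cancels against [n] copies of [line_series al] and of every [u H] with [H]
    above [F]. The exponents left are those attached to [F |: S]. *)
Lemma partial_series_step S F l (m m' : A) n : increasing (F :: l) ->
    nested_var M (F |: S) -> outside S F -> {in l, forall H, outside S H} ->
    m = xprod S * m' -> rk (cov (F |: S)) = (rk (cov S) + n)%N ->
  m *: 'X^(rk (cov S)) * (x F *: 'X) * ((th F *: 'X) ^+ n.-1 * v F ^+ n) *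
    (line_series al ^+ (rank M - rk (cov S)) * \prod_(H <- l) factor S H) =
  partial_series (F |: S) (m * (x F * th F ^+ n.-1)) l.
Proof.
move=> incF nT oF ol em en; have [_ Fl lF Fup] := increasing_cons incF.
have n0 : (0 < n)%N.
  have nS : nested_var M S by apply: nested_var_sub nT; rewrite subsetUr.
  by move: (rk_cov_nested_lt nS oF) en; clear; lia.
have FS : F \notin S by apply/negP=> /oF; rewrite subxx.
have rT := rk_cov_lt M_loopless G_building G_E nT.
set y := m * (x F * th F ^+ n.-1).
have -> : m *: 'X^(rk (cov S)) * (x F *: 'X) * ((th F *: 'X) ^+ n.-1 * v F ^+ n) =
          'X^(rk (cov (F |: S))) * v F ^+ n * y%:P.
  rewrite exprZn -!mul_polyC /y !rmorphM /= en.
  have -> : (rk (cov S) + n = rk (cov S) + 1 + n.-1)%N by move: n0; clear; lia.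
  rewrite !exprD expr1; move: (v F ^+ n) m%:P (x F)%:P (th F ^+ n.-1)%:P => w a b c.
  by move: 'X^(rk (cov S)) => t1; move: 'X^(n.-1) => t2; move: 'X => t3; ring.
have ey : y = xprod (F |: S) * (m' * th F ^+ n.-1) 
  by rewrite /y xprodU1 // em mulrACA [xprod S * x F]mulrC.
(* For [H] above [F] the exponent drops by [n]. For [H] incomparable with [F] it stays the same, or
   else [y] kills [x H] and both factors act trivially. *)
pose g H : {poly A} := factor (F |: S) H * (if val F \proper val H then u H else 1) ^+ n.
have eg : y%:P * \prod_(H <- l) factor S H = y%:P * \prod_(H <- l) g H.
  apply: mul_prod_congr => H Hl; rewrite /g; case: (boolP (val F \proper val H)) => FH.
    congr (_ * _); rewrite /factor -mulrA -exprD; congr (_ * _ ^+ _).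
    have -> : cov (H |: (F |: S)) = cov (H |: S).
      by rewrite !covU1 setUA; congr (_ :|: _); exact/setUidPl/proper_sub.
    have : (rk (cov (F |: S)) <= rk (cov (H |: S)))%N.
      by rewrite !covU1 rk_mono // setSU // proper_sub.
    by move: en; clear; lia.
  rewrite expr1n mulr1.
  have nHF : ~~ (val H \subset val F) := lF H Hl.
  have nFH : ~~ (val F \subset val H) by move: FH; rewrite properE nHF andbT.
  have [nHT|nHT] := boolP (nested_var M (H |: (F |: S))).
    congr (_ * _); rewrite /factor (rk_cov_gain_indep M_loopless G_building nHT) //.
    by move=> K; rewrite !inE => /orP [/eqP -> //|]; exact: ol.
  have yx : y%:P * (x H *: 'X) = 0.
    by rewrite -mul_polyC mulrA -polyCM ey mulrAC [_ * x H]mulrC x_xprod0 // mul0r mul0r.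
  by rewrite !factor_id.
(* Telescoping along [F :: l] gives [line_series (xi F)], because the list contains everything
   strictly above [F]. *)
have tel : line_series al * v F * \prod_(H <- l | val F \proper val H) u H = 1.
  have [ul pl upl] := incF.
  have -> : \prod_(H <- l | val F \proper val H) u H =
            \prod_(H <- F :: l | val F \proper val H) u H.
    by rewrite big_cons properxx.
  rewrite mulrAC line_al_prod_u // -[RHS](line_xi_v F); congr (line_series (al - _) * _).
  rewrite -big_filter big_uniq ?filter_uniq //; apply: eq_bigl => H.
  by rewrite mem_filter; apply: andb_idr => /Fup; rewrite inE orbC => ->.
have eprod : \prod_(H <- l) g H =
    \prod_(H <- l) factor (F |: S) H * (\prod_(H <- l | val F \proper val H) u H) ^+ n.
  by rewrite big_split /= prodrXl -big_mkcond.
rewrite mulrACA eg eprod /partial_series.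
have -> : (rank M - rk (cov S) = rank M - rk (cov (F |: S)) + n)%N.
  by move: rT en; clear; lia.
rewrite -mul_polyC exprD.
transitivity (y%:P * 'X^(rk (cov (F |: S))) *
   (line_series al ^+ (rank M - rk (cov (F |: S))) * \prod_(H <- l) factor (F |: S) H) *
   (line_series al * v F * \prod_(H <- l | val F \proper val H) u H) ^+ n); last first.
  by rewrite tel expr1n mulr1.
rewrite !exprMn; move: (line_series al ^+ _) (line_series al ^+ n) (v F ^+ n) => a b c.
move: (\prod_(H <- l) _) (_ ^+ n) y%:P => p q y'; move: 'X^_ => t.
by ring.
Qed.

(** A term with [th F ^+ a], [a < n], leaves total degree [d - rk (cov S) - 1 - a] for [al] and the
    variables outside [F |: S]; [lifts_eq0] kills it, since the rank gained is [n.+1]. *)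
Lemma partial_series_low S F l (m m' : A) n k (L : {poly A}) : (k <= d)%N ->
    increasing (F :: l) ->
    nested_var M (F |: S) -> outside S F -> {in l, forall H, outside S H} ->
    m = xprod S * m' -> rk (cov (F |: S)) = (rk (cov S) + n.+1)%N ->
    low_degree (th F *: 'X) (liftsp (F |: S)) n L ->
  al ^+ (d - k) * (m *: 'X^(rk (cov S)) * (x F *: 'X) * L *
    (line_series al ^+ (rank M - rk (cov S)) * \prod_(H <- l) factor S H))`_k = 0.
Proof.
move=> kd incF nT oF ol em en; have [_ Fl lF Fup] := increasing_cons incF.
have FS : F \notin S by apply/negP=> /oF; rewrite subxx.
have oT H : H \in l -> outside (F |: S) H.
  by move=> Hl K; rewrite !inE => /orP [/eqP ->|]; [exact: lF | exact: ol].
have liftl : liftsp (F |: S)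
    (line_series al ^+ (rank M - rk (cov S)) * \prod_(H <- l) factor S H).
  apply: liftspM; first exact/liftsp_exp/liftsp_line/lifts_al.
  rewrite big_seq; apply: big_ind => [|p q|H Hl]; [exact: liftsp1 | exact: liftspM |].
  have lx : lifts (F |: S) 1 (x H) by apply: lifts_x; exact: oT.
  have lxi : lifts (F |: S) 1 (xi H).
    apply: lifts_xi => // K HK K' KT; apply: contra (oT H Hl K' KT).
    exact: subset_trans (proper_sub HK).
  rewrite /factor uE; apply: liftspM; first exact: liftsp_line.
  apply: liftsp_exp; apply: liftspD; first exact: liftsp1.
  by apply/liftspN/liftspM; [exact: liftspZX | exact: liftsp_line_inv].
set w := line_series al ^+ _ * _ in liftl *.
(* The bound in [low_degree] is decoupled from [n] to allow induction on [hL]. *)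
have [j] : exists j, j = n by exists n.
move=> ej; rewrite -{1}ej => hL; have {ej} jn : (j <= n)%N by rewrite ej.
elim: j L / hL jn => [j0 _|a j0 c aj lc jn|j0 y z _ IHy _ IHz jn]; last 2 first.
- have -> : m *: 'X^(rk (cov S)) * (x F *: 'X) * ((th F *: 'X) ^+ a * c) * w =
            'X^(rk (cov S) + 1 + a) * ((m * (x F * th F ^+ a))%:P * (c * w)).
    rewrite exprZn -!mul_polyC !rmorphM /= !exprD expr1.
    move: m%:P (x F)%:P (th F ^+ a)%:P (w) => a1 a2 a3 a4.
    by move: 'X^(rk (cov S)) => t1; move: 'X^a => t2; move: 'X => t3; ring.
  rewrite coefXnM; case: ltnP => hk; first by rewrite mulr0.
  rewrite coefCM; set i := (k - _)%N.
  have -> : al ^+ (d - k) * (m * (x F * th F ^+ a) * (c * w)`_i) =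
            m' * th F ^+ a * (xprod (F |: S) * (al ^+ (d - k) * (c * w)`_i)).
    by rewrite xprodU1 // em; move: (al ^+ _) (th F ^+ a) (_`_i) => a1 a2 a3; ring.
  rewrite (@lifts_eq0 _ (d - k + i)) ?mulr0 //.
    by apply: liftsM; [exact/liftsX/lifts_al | exact: (liftspM lc liftl)].
  by move: en rank_d hk kd aj jn; rewrite /i; clear; lia.
- by rewrite mulrDr mulrDl coefD mulrDr IHy ?IHz ?addr0.
- by rewrite mulr0 mul0r coef0 mulr0.
Qed.

(** Each flat of [l] is either omitted or adjoined to [S]. The last two hypotheses are the
    invariants of [m]; the lower bound comes from omitting all remaining flats. *)
Lemma partial_series_coef k l S (m m' : A) : (k <= d)%N -> increasing l ->
    nested_var M S -> {in l, forall H, outside S H} ->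
    m = xprod S * m' -> m * al ^+ (d - rk (cov S)) = al ^+ d ->
  exists2 n, al ^+ (d - k) * (partial_series S m l)`_k = al ^+ d *+ n &
    (rk (cov S) <= k)%N -> ('C(rank M - rk (cov S), k - rk (cov S)) <= n)%N.
Proof.
move=> kd; elim: l S m m' => [|F l IH] S m m' incl nS ol em ml.
  rewrite /partial_series big_nil mulr1 -scalerAl coefZ coefXnM; case: ltnP => hk.
    by exists 0%N; rewrite ?mulr0 ?mulr0n // leqNgt hk.
  exists 'C(rank M - rk (cov S), k - rk (cov S)) => //.
  rewrite coef_line_series_exp !mulrnAr; congr (_ *+ _).
  rewrite mulrCA -exprD -ml; congr (_ * _ ^+ _).
  by move: hk kd; clear; lia.
have [incl' Fl lF Fup] := increasing_cons incl.
have oF : outside S F by apply: ol; rewrite inE eqxx.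
have ol' : {in l, forall H, outside S H} by move=> H Hl; apply: ol; rewrite inE Hl orbT.
have FS : F \notin S by apply/negP=> /oF; rewrite subxx.
have [n1 e1 hn1] := IH S m m' incl' nS ol' em ml.
set base := line_series al ^+ (rank M - rk (cov S)).
set Q := \prod_(H <- l) factor S H.
have eP : partial_series S m (F :: l) = m *: 'X^(rk (cov S)) * factor S F * (base * Q).
  by rewrite /partial_series big_cons -[RHS]mulrA; congr (_ * _); exact: mulrCA.
(* If [F] cannot be adjoined, [m] kills [x F] and the factor acts as 1. *)
have [nT|nT] := boolP (nested_var M (F |: S)); last first.
  exists n1 => //; rewrite eP factor_id //.
  rewrite -scalerAl -scalerAr scalerA em.
  by rewrite mulrAC [_ * x F]mulrC x_xprod0 // mul0r scale0r.
have /subnKC := rk_cov_nested_lt nS oF.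
set n := (rk (cov (F |: S)) - (rk (cov S)).+1)%N => en.
have {}en : rk (cov (F |: S)) = (rk (cov S) + n.+1)%N by rewrite -en addSnnS.
have rT := rk_cov_lt M_loopless G_building G_E nT.
pose mT := m * (x F * th F ^+ n).
have oT : {in l, forall H, outside (F |: S) H}.
  by move=> H Hl K; rewrite !inE => /orP [/eqP ->|]; [exact: lF | exact: ol'].
have emT : mT = xprod (F |: S) * (m' * th F ^+ n).
  by rewrite /mT xprodU1 // em mulrACA [xprod S * x F]mulrC.
have mlT : mT * al ^+ (d - rk (cov (F |: S))) = al ^+ d.
  have eb : rank M = (d - rk (cov (F |: S)) + rk (cov (F |: S))).+1.
    by move: rank_d rT; clear; lia.
  transitivity (m' * (xprod S * (x F * th F ^+ n) * al ^+ (d - rk (cov (F |: S))))).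
    by rewrite /mT em [xprod S * m']mulrC -!mulrA.
  rewrite (xprod_th_al nT oF en eb) -ml em mulrA [m' * _]mulrC; congr (_ * _ ^+ _).
  by move: rank_d rT en; clear; lia.
have [n2 e2 _] := IH (F |: S) mT _ incl' nT oT emT mlT.
have lv : liftsp (F |: S) (v F).
  by apply/liftsp_line_inv/lifts_xi => // H /Fup; exact: oT.
have v_inv : (1 + (th F *: 'X + x F *: 'X)) * v F = 1.
  by rewrite -scalerDl -xiE; exact: line_xi_v.
have lvM c : liftsp (F |: S) c -> liftsp (F |: S) (c * v F).
  by move=> lc; exact: liftspM.
have lvX i j : liftsp (F |: S) (v F ^+ i *+ j) by exact/liftspMn/liftsp_exp.
have [L hL eF] := blowup_factor v_inv (liftspN lv) lvM lvX n.
set Z := m *: 'X^(rk (cov S)) in eP.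
set X := x F *: 'X in eF; set t := th F *: 'X in eF hL.
have eZ : partial_series S m (F :: l) =
    partial_series S m l + Z * X * L * (base * Q)
    + (Z * X * (t ^+ n * v F ^+ n.+1) * (base * Q)) *+ n
    + Z * t ^+ n.+1 * (X * v F ^+ n.+1 * (base * Q)).
  have -> : partial_series S m l = Z * (base * Q) by [].
  rewrite eP /factor en addKn eF.
  by move: (v F ^+ n.+1) (t ^+ n) (t ^+ n.+1) (base * Q) => a1 a2 a3 a4; ring.
have t0 : Z * t ^+ n.+1 = 0.
  rewrite /Z /t exprZn -scalerAl -scalerAr scalerA em mulrAC xprod_th_eq0 ?mul0r ?scale0r //.
  by rewrite en addnC.
have step := partial_series_step incl nT oF ol' em en; rewrite -/X -/t -/Z -/base -/Q in step.
(* [n1] comes from omitting [F], [n2] from adjoining it; [n] is one less than the rank gained, the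
   multiplicity found in [blowup_factor]. *)
exists (n1 + n2 * n)%N; last by move/hn1/leq_trans; apply; exact: leq_addr.
rewrite eZ t0 mul0r addr0 step !coefD coefMn !mulrDr mulrnAr e1 e2.
by rewrite (partial_series_low kd incl nT oF ol' em en hL) addr0 mulrnDr mulrnA.
Qed.

(** Inverses are unique at precision [n]. This reconciles the precision [k] of [chern] with the
    precision [d] of [v]. *)
Lemma line_series_inv_prec n n' D : (n <= n')%N ->
  teq n (line_series_inv n D) (line_series_inv n' D).
Proof.
move=> nn'; apply: (teq_cancel (line_series_coef0 D)).
rewrite mulrC; apply: teq_trans (line_series_invP _ _) _.
apply/teqP => j hj; rewrite mulrC; have /teqP -> // := line_series_invP n' D.
exact: leq_trans hj nn'.
Qed.

Lemma increasing_sort_enum :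
  increasing (sort (relpre (fun F => #|val F|) leq) (enum {: gvar G})).
Proof.
set r := relpre _ _; have ul : uniq (sort r (enum {: gvar G})) by rewrite sort_uniq enum_uniq.
split=> //; last by move=> F H _ _; rewrite mem_sort mem_enum.
have r_tot : total r by move=> F H; exact: leq_total.
have r_trans : transitive r by move=> F H K; exact: leq_trans.
have := sort_sorted r_tot (enum {: gvar G}); rewrite (sorted_pairwise r_trans) => pr.
have : pairwise [rel F H | r F H && (F != H)] (sort r (enum {: gvar G})).
  by rewrite pairwise_relI pr -uniq_pairwise.
apply: sub_pairwise => F H /= /andP [FH neFH]; apply: contra neFH => HF.
by rewrite eq_sym -val_eqE eqEcard HF.
Qed.

(** The expansion starts from [S = set0] and [m = 1], where the exponent of each [u F] is
    [rk (val F)]. *)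
Lemma chern_coef_al k : (k <= d)%N ->
  exists2 n, al ^+ (d - k) * (line_series al ^+ rank M * \prod_(F : gvar G)
      (line_series (x F) * (line_series (th F) * line_series_inv k (xi F)) ^+ rk (val F)))`_k
    = al ^+ d *+ n & ('C(d.+1, k) <= n)%N.
Proof.
move=> kd; set l := sort (relpre (fun F => #|val F|) leq) (enum {: gvar G}).
have n0 : nested_var M (set0 : {set gvar G}) by exact: nested_var0.
have o0 : {in l, forall H, outside set0 H} by move=> H _ K; rewrite inE.
have r0 : rk (cov (set0 : {set gvar G})) = 0%N by rewrite cov0 rk0.
have eX : 1 = xprod set0 * 1 by rewrite /xprod big_set0 mulr1.
have [|n e hn] := partial_series_coef kd increasing_sort_enum n0 o0 eX.
  by rewrite r0 subn0 mul1r.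
exists n; last by move: hn; rewrite r0 !subn0 rank_d; exact.
rewrite -e /partial_series r0 subn0 expr0 scale1r mul1r; congr (_ * _).
have -> : \prod_(H <- l) factor set0 H = \prod_(F : gvar G) factor set0 F.
  rewrite -[RHS]big_enum /=; apply: perm_big; exact/permPl/perm_sort.
have /teqP -> // : teq k (line_series al ^+ rank M * \prod_(F : gvar G)
    (line_series (x F) * (line_series (th F) * line_series_inv k (xi F)) ^+ rk (val F)))
  (line_series al ^+ rank M * \prod_(F : gvar G) factor set0 F).
apply: teqM => //; apply: teq_prod => F _.
rewrite /factor covU1 cov0 setU0 rk0 subn0; apply: teqM => //; apply: teqX.
by apply: teqM => //; exact: line_series_inv_prec.
Qed.

End ChowAlgebra.

(** * The degree map and the inequality *)

Section DegreeMap.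
Variables (E : finType) (M : matroid E) (G : {set {set E}}).

Lemma alpha_exp_gr i n : c1 (alpha M G i) ^+ n \in gr n.
Proof.
elim: n => [|n IH]; first by rewrite expr0; exact: gr1_one.
by rewrite exprS -add1n; apply: grM IH; exact: valP.
Qed.

Lemma degree_iso_mulrn i d (deg : chow M G -> int) n : degree_iso i d deg ->
  deg (c1 (alpha M G i) ^+ d *+ n) = n.
Proof.
case=> degD _ _ deg1; have ad := alpha_exp_gr i d.
have deg0 : deg 0 = 0.
  by apply: (addrI (deg 0)); rewrite -degD ?rpred0 // !addr0.
elim: n => [|n IH]; first by rewrite mulr0n.
by rewrite mulrS degD ?rpredMn // deg1 IH intS.
Qed.

End DegreeMap.

Theorem corollary2 (E : finType) (i : E) (M : matroid E) (M_loopless : loopless M)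
    (G : {set {set E}}) (G_building : building_set M G) (G_E : [set: E] \in G)
    (d : nat) (d_def : d = (rank M - 1)%N)
    (deg : chow M G -> int) (deg_iso : degree_iso i d deg)
    (k : nat) (k_le_d : (k <= d)%N) :
  ('C(d + 1, k))%:Z <= deg (chern k (tangent M G i) * c1 (alpha M G i) ^+ (d - k)).
Proof.
(* The point [i] is not a loop, so the rank is positive and the subtraction in [d_def] is not
   truncated. *)
have rank_d : rank M = d.+1.
  have := M_loopless i; have := rk_mono M (subsetT [set i]).
  by rewrite /rank in d_def *; lia.
pose x (F : gvar G) : chow M G := c1 (x_ M F).
have x_nonnested (S : {set gvar G}) : ~~ nested_var M S -> \prod_(F in S) x F = 0.
  by move=> /x_nonnested; rewrite big_map big_enum.
have alphaE e : c1 (alpha M G e) = al x e by rewrite raddf_sum.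
have x_linear e f : \sum_(F : gvar G | e \in val F) x F = \sum_(F : gvar G | f \in val F) x F.
  by rewrite -[LHS]/(al x e) -[RHS]/(al x f) -!alphaE (alpha_indep M G e f).
have thetaE F : c1 (theta M i F) = th x i F by rewrite raddfB alphaE raddf_sum.
have c1xiE F : c1 (theta M i F + x_ M F) = xi x i F by rewrite raddfD thetaE (xiE x i).
have [n e hn] := chern_coef_al M_loopless G_building G_E i x_nonnested x_linear rank_d k_le_d.
suff -> : chern k (tangent M G i) * c1 (alpha M G i) ^+ (d - k) = c1 (alpha M G i) ^+ d *+ n.
  by rewrite degree_iso_mulrn // lez_nat addn1.
rewrite alphaE -e [LHS]mulrC chern_tangent alphaE.
by under eq_bigr => F _ do rewrite thetaE c1xiE.
Qed.
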